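(* Let $\mathcal{H}$ be a pure contractive $\mathcal{A}_d$-module, and let $\varphi$ be a Möbius transform of the unit ball with $\lambda=\varphi^{-1}(0)$. Let $$\cdots \xrightarrow{\partial'_3} E_2 \xrightarrow{\partial'_2} E_1 \xrightarrow{\partial'_1} E_0 \to 0$$ be the Koszul complex of the Möbius transform $(\mathcal{H})_\varphi$ of $\mathcal{H}$, and let $$\cdots \xrightarrow{\Phi_3(\lambda)} \mathcal{C}_2 \xrightarrow{\Phi_2(\lambda)} \mathcal{C}_1 \xrightarrow{\Phi_1(\lambda)} \mathcal{C}_0$$ be the localization at $\lambda$ of a free resolution $\cdots\xrightarrow{\Phi_2}H_d^2\otimes\mathcal{C}_1\xrightarrow{\Phi_1}H_d^2\otimes\mathcal{C}_0\xrightarrow{\Phi_0}\mathcal{H}\to 0$ of $\mathcal{H}$. Then for $k\ge1$, $$\frac{\ker \partial'_k}{\operatorname{im} \partial'_{k+1}} \cong \frac{\ker \Phi_k(\lambda)}{\operatorname{im}\Phi_{k+1}(\lambda)}$$ (isomorphism of complex vector spaces).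
   Context: $\mathcal{A}_d=\mathbb{C}[z_1,\dots,z_d]$, and $B_d$ is the open unit ball of $\mathbb{C}^d$. A contractive $\mathcal{A}_d$-module is a Hilbert space $\mathcal{H}$ that is an $\mathcal{A}_d$-module with $\|\sum_{k=1}^d z_k\xi_k\|^2\le \sum_{k=1}^d\|\xi_k\|^2$ for all $\xi_1,\dots,\xi_d\in\mathcal{H}$; its associated $d$-tuple is $(T_1,\dots,T_d)$ with $T_i\xi=z_i\xi$. If $\mathcal{K}$ is a closed submodule, the quotient $\mathcal{H}/\mathcal{K}$ is identified with $\mathcal{H}\ominus\mathcal{K}$, with polynomials acting by compression to $\mathcal{H}\ominus\mathcal{K}$; it is again a contractive module. $H_d^2$ is the Hilbert space of holomorphic functions on $B_d$ with reproducing kernel $k(z,\lambda)=\frac{1}{1-\langle z,\lambda\rangle}$; $\mathcal{A}_d$ acts on it by multiplication, making it a contractive $\mathcal{A}_d$-module. A free module is a module $H_d^2\otimes\mathcal{C}$ with $\mathcal{C}$ a Hilbert space of arbitrary dimension ($\mathcal{A}_d$ acting on the first factor). A contractive $\mathcal{A}_d$-module is pure if it is unitarily isomorphic (as a module) to a quotient of a free module by a closed submodule. An element $\xi\in H_d^2\otimes\mathcal{C}$ is viewed as a $\mathcal{C}$-valued function on $B_d$ via $\langle\xi(\lambda),\eta\rangle_{\mathcal{C}}=\langle \xi,k_\lambda\otimes\eta\rangle$ for $\eta\in\mathcal{C}$, where $k_\lambda=k(\cdot,\lambda)$. For a (bounded) module homomorphism $\Phi:H_d^2\otimes\mathcal{D}\to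 H_d^2\otimes\mathcal{C}$ and $\lambda\in B_d$, $\Phi(\lambda):\mathcal{D}\to\mathcal{C}$ is the bounded operator $\Phi(\lambda)\eta=(\Phi(1\otimes\eta))(\lambda)$. A free resolution of $\mathcal{H}$ is an exact sequence $\cdots\xrightarrow{\Phi_2}\mathcal{F}_1\xrightarrow{\Phi_1}\mathcal{F}_0\xrightarrow{\Phi_0}\mathcal{H}\to0$ in which each $\mathcal{F}_i=H_d^2\otimes\mathcal{C}_i$ is free and each $\Phi_i$ is a partially isometric module homomorphism. A Möbius transform is a continuous bijection $\varphi:\overline{B_d}\to\overline{B_d}$ that is holomorphic in $B_d$ and satisfies $\varphi(B_d)=B_d$, $\varphi(\partial B_d)=\partial B_d$; $\varphi^1,\dots,\varphi^d$ are its coordinate functions. With $\lambda=\varphi^{-1}(0)\in B_d$, each $\varphi^i$ has the form $\varphi^i(z)=\ell_i(z)/(1-\langle z,\lambda\rangle)$ with $\ell_i$ a polynomial of degree at most one. The Möbius transform $(\mathcal{H})_\varphi$ of $\mathcal{H}$ is the $\mathcal{A}_d$-module with underlying Hilbert space $\mathcal{H}$ and action $z_i\cdot\xi=\varphi^i(T_1,\dots,T_d)\xi$, $\xi\in\mathcal{H}$, where $\varphi^i(T_1,\dots,T_d)=\ell_i(T_1,\dots,T_d)(1-\sum_k\overline{\lambda_k}T_k)^{-1}$ (the inverse exists because $\|\sum_k\overline{\lambda_k}T_k\|\le|\lambda|<1$). The Koszul complex of an $\mathcal{A}_d$-module $\mathcal{M}$: $E_k=\mathcal{M}\otimes\bigwedge^k\mathbb{C}^d$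 (zero for $k<0$ or $k>d$), and, for a fixed orthonormal basis $e_1,\dots,e_d$ of $\mathbb{C}^d$, the map $E_k\to E_{k-1}$ is $\xi\otimes e_{i_1}\wedge\cdots\wedge e_{i_k}\mapsto\sum_{j=1}^k(-1)^{j+1}z_{i_j}\cdot\xi\otimes e_{i_1}\wedge\cdots\wedge\widehat{e_{i_j}}\wedge\cdots\wedge e_{i_k}$. For $\mathcal{M}=(\mathcal{H})_\varphi$ these maps are denoted $\partial'_k$. *)

(* Defs.v *)
From HB Require Import structures.
From mathcomp Require Import all_boot all_order all_algebra.
From mathcomp Require Import complex.
From mathcomp Require mpoly.
From mathcomp Require Import all_classical all_reals all_analysis.
(* The notations of mpoly clash with those of mathcomp-analysis. *)
Import -(notations) mpoly.

Set Implicit Arguments.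
Unset Strict Implicit.
Unset Printing Implicit Defensive.

Import Order.TTheory GRing.Theory Num.Theory.
Import numFieldNormedType.Exports.

Local Open Scope classical_set_scope.
Local Open Scope ring_scope.

(* [homology f g] is the vector space ker g / im f of U -f-> V -g-> W; as *)
(* im f need not be included in ker g, the divisor is im f intersected with ker g. *)
Section Homology.
Context {K : pzRingType} {U V W : lmodType K}.
Variables (f : {linear U -> V}) (g : {linear V -> W}).

Definition ker_pred : {pred V} := [pred v | g v == 0].

Fact ker_pred_submod : submod_closed ker_pred.
Proof.
split=> [|a u v]; rewrite !inE ?raddf0 ?eqxx// => /eqP gu /eqP gv.
by rewrite linearP gu gv scaler0 addr0.
Qed.
HB.instance Definition _ := GRing.isSubmodClosed.Build K V ker_pred
  ker_pred_submod.

Record kernel := Kernel { kernel_val : V; _ : kernel_val \in ker_pred }.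
HB.instance Definition _ := [isSub for kernel_val].
HB.instance Definition _ := [Choice of kernel by <:].
HB.instance Definition _ := [SubChoice_isSubLmodule of kernel by <:].

Definition im_pred : {pred kernel} := [pred v | `[< exists u, f u = val v >]].

Fact im_pred_zmod : zmod_closed im_pred.
Proof.
split=> [|x y]; first by rewrite inE; exists 0; rewrite !raddf0.
by rewrite !inE => -[u fu] [v fv]; exists (u - v); rewrite !raddfB /= fu fv.
Qed.
HB.instance Definition _ := GRing.isZmodClosed.Build kernel im_pred im_pred_zmod.

Local Open Scope quotient_scope.

Definition homology := Quotient.quot im_pred.
HB.instance Definition _ := GRing.Zmodule.on homology.
HB.instance Definition _ := EqQuotient.on homology.

Definition homology_scale (a : K) (x : homology) : homology :=
  \pi_homology (a *: repr x).

Fact homologyW (P : homology -> Prop) :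
  (forall v : kernel, P (\pi_homology v)) -> forall x, P x.
Proof. by move=> Pv x; rewrite -[x]reprK. Qed.

Fact homology_scale_pi a (v : kernel) :
  homology_scale a (\pi_homology v) = \pi_homology (a *: v).
Proof.
rewrite /homology_scale; apply/eqP; rewrite -Quotient.idealrBE -scalerBr.
have : (repr (\pi_homology v) - v) \in im_pred.
  by rewrite Quotient.idealrBE; apply/eqP; rewrite reprK.
by rewrite !inE => -[u fu]; exists (a *: u); rewrite !linearZ /= fu.
Qed.

Fact homology_scaleA a b x :
  homology_scale a (homology_scale b x) = homology_scale (a * b) x.
Proof. by elim/homologyW: x => x; rewrite !homology_scale_pi scalerA. Qed.

Fact homology_scale1 : left_id 1 homology_scale.
Proof. by elim/homologyW => x; rewrite homology_scale_pi scale1r. Qed.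

Fact homology_pi_add (v w : kernel) :
  \pi_homology (v + w) = \pi_homology v + \pi_homology w.
Proof. exact: Quotient.pi_add. Qed.

Fact homology_scaleDr : right_distributive homology_scale +%R.
Proof.
move=> a; elim/homologyW => x; elim/homologyW => y.
by rewrite -homology_pi_add !homology_scale_pi scalerDr homology_pi_add.
Qed.

Fact homology_scaleDl x : {morph homology_scale^~ x : a b / a + b}.
Proof.
move=> a b; elim/homologyW: x => x.
by rewrite !homology_scale_pi scalerDl homology_pi_add.
Qed.

HB.instance Definition _ := GRing.Zmodule_isLmodule.Build K homology
  homology_scaleA homology_scale1 homology_scaleDr homology_scaleDl.
End Homology.

Definition lin_iso (K : pzRingType) (U V : lmodType K) : Prop :=
  exists h : {linear U -> V}, bijective h.

(* The inner product is linear in its first argument and conjugate-linear in *)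
(* its second one. *)
HB.mixin Record isHilbert (R : realType) (V : Type)
    of CompleteNormedModule R[i] V := {
  hdot : {dot V for @Num.conj R[i]} ;
  hdot_norm : forall x : V, hdot x x = `|x| ^+ 2
}.

#[short(type="hilbertType")]
HB.structure Definition Hilbert (R : realType) :=
  {V of isHilbert R V & CompleteNormedModule R[i] V}.

Lemma hdotPl (R : realType) (H : hilbertType R) a (x y z : H) :
  hdot (a *: x + y) z = a * hdot x z + hdot y z.
Proof. exact: linearPl. Qed.

Lemma hdot_inj (R : realType) (H : hilbertType R) (x y : H) :
  (forall z, hdot x z = hdot y z) -> x = y.
Proof.
move=> xy; apply/eqP; rewrite -subr_eq0 -normr_eq0 -sqrf_eq0 -hdot_norm.
by rewrite -[x]scale1r -scaleN1r addrC hdotPl scale1r xy mulN1r addNr.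
Qed.

(* The topology of C^d is that of the sup norm, which is equivalent to the *)
(* Euclidean one; the balls below are the Euclidean ones. *)
Definition Cn (R : realType) (d : nat) : normedModType R[i] := 'rV[R[i]]_d.

Section Ball.
Context {R : realType} {d : nat}.

Definition Cdot (z w : Cn R d) : R[i] := \sum_(i < d) z 0 i * (w 0 i)^*.
Definition Csqnorm (z : Cn R d) : R[i] := \sum_(i < d) `|z 0 i| ^+ 2.

Definition oball : set (Cn R d) := [set z | Csqnorm z < 1].
Definition cball : set (Cn R d) := [set z | Csqnorm z <= 1].
Definition csphere : set (Cn R d) := [set z | Csqnorm z = 1].

Fact oball0_subproof : (0 : Cn R d) \in oball.
Proof.
by rewrite inE /oball /= /Csqnorm big1 ?ltr01// => i _; rewrite mxE normr0 expr0n.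
Qed.
Definition oball0 : oball := exist _ 0 oball0_subproof.

End Ball.
Arguments oball R d : clear implicits.
Arguments cball R d : clear implicits.
Arguments csphere R d : clear implicits.

Definition Apoly (R : realType) (d : nat) : comNzRingType := mpoly d R[i].
Definition zvar (R : realType) (d : nat) (i : 'I_d) : Apoly R d :=
  mpolyX R[i] (mnm1 i).
Definition cpoly (R : realType) (d : nat) (c : R[i]) : Apoly R d := mpolyC d c.
Definition peval (R : realType) (d : nat) (p : Apoly R d) (z : Cn R d) : R[i] :=
  meval (fun i => z 0 i) p.

(* A module over C[z_1, ..., z_d] on H whose restriction to the constants is *)
(* the vector space structure of H. *)
Record Ad_module (R : realType) (d : nat) (H : hilbertType R) := AdModule {
  act :> Apoly R d -> {linear H -> H} ;
  actD : forall p q x, act (p + q) x = act p x + act q x ;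
  actM : forall p q x, act (p * q) x = act p (act q x) ;
  actC : forall c x, act (cpoly d c) x = c *: x
}.

Section Modules.
Context {R : realType} {d : nat}.
Implicit Types H K : hilbertType R.

Definition contractive H (M : Ad_module d H) : Prop :=
  forall x : 'I_d -> H,
    `|\sum_(i < d) M (zvar R i) (x i)| ^+ 2 <= \sum_(i < d) `|x i| ^+ 2.

Definition module_hom H K (M : Ad_module d H) (N : Ad_module d K)
    (f : {linear H -> K}) : Prop :=
  continuous f /\ forall p x, f (M p x) = N p (f x).

Definition orthogonal_to H (N : set H) : set H :=
  [set x | forall y, N y -> hdot x y = 0].

Definition closed_submodule H (M : Ad_module d H) (N : set H) : Prop :=
  [/\ closed N, N 0,
      forall x y, N x -> N y -> N (x + y)
    & forall p x, N x -> N (M p x)].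

Definition partial_isometry H K (f : {linear H -> K}) : Prop :=
  continuous f /\
  forall x, orthogonal_to [set y | f y = 0] x -> `|f x| = `|x|.

(* M is unitarily isomorphic, through u, to the quotient of L by N, i.e. to the *)
(* orthogonal complement of N with the compressed action; the compression of *)
(* L p to that complement maps y to its only element congruent to L p y *)
(* modulo N. *)
Definition quotient_iso H K (M : Ad_module d H) (L : Ad_module d K) (N : set K)
    (u : {linear H -> K}) : Prop :=
  [/\ forall x y, hdot (u x) (u y) = hdot x y,
      range u = orthogonal_to N
    & forall p x, N (L p (u x) - u (M p x))].

(* T is the Hilbert space tensor product of H and K. *)
Record hilbert_tensor H K (T : hilbertType R) := HilbertTensor {
  tensor :> {bilinear H -> K -> T} ;
  tensor_dot : forall x x' y y',
    hdot (tensor x y) (tensor x' y') = hdot x x' * hdot y y' ;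
  tensor_dense : dense [set t : T |
    exists n (x : 'I_n -> H) (y : 'I_n -> K), t = \sum_(i < n) tensor (x i) (y i)]
}.

(* H is the space H_d^2, its elements being functions through da_eval; the *)
(* values of da_eval outside of the open ball are irrelevant. *)
Record drury_arveson H := DruryArveson {
  da_eval : H -> Cn R d -> R[i] ;
  da_eval_linear : forall a f g z, oball R d z ->
    da_eval (a *: f + g) z = a * da_eval f z + da_eval g z ;
  da_eval_inj : forall f g,
    (forall z, oball R d z -> da_eval f z = da_eval g z) -> f = g ;
  da_holomorphic : forall f z, oball R d z ->
    differentiable (da_eval f : Cn R d -> R[i]^o) z ;
  da_kernel : oball R d -> H ;
  da_kernelE : forall (l : oball R d) z, oball R d z ->
    da_eval (da_kernel l) z = (1 - Cdot z (val l))^-1 ;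
  da_reproducing : forall f (l : oball R d),
    hdot f (da_kernel l) = da_eval f (val l) ;
  da_module : Ad_module d H ;
  da_moduleE : forall p f z, oball R d z ->
    da_eval (da_module p f) z = peval p z * da_eval f z ;
  da_contractive : contractive da_module
}.

Definition da_one H (D : drury_arveson H) : H := da_kernel D oball0.

Lemma da_oneE H (D : drury_arveson H) z : oball R d z -> da_eval D (da_one D) z = 1.
Proof.
move=> zB; rewrite da_kernelE// /Cdot big1 ?subr0 ?invr1// => i _.
by rewrite mxE conjC0 mulr0.
Qed.

(* F is the free module H_d^2 (x) C, its elements being C-valued functions on *)
(* the ball through free_eval (which exists by Riesz and is unique). *)
Record free_module H2 (D : drury_arveson H2) (C F : hilbertType R) := FreeModule {
  free_tensor : hilbert_tensor H2 C F ;
  free_act :> Ad_module d F ;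
  free_actE : forall p f y,
    free_act p (free_tensor f y) = free_tensor (da_module D p f) y ;
  free_contractive : contractive free_act ;
  free_eval : F -> oball R d -> C ;
  free_evalE : forall x l y,
    hdot (free_eval x l) y = hdot x (free_tensor (da_kernel D l) y)
}.

Definition pure H2 (D : drury_arveson H2) H (M : Ad_module d H) : Prop :=
  exists (C F : hilbertType R) (L : free_module D C F) (N : set F)
         (u : {linear H -> F}),
    closed_submodule L N /\ quotient_iso M L N u.

Section Localization.
Context {H2 : hilbertType R} {D : drury_arveson H2}.
Context {C1 F1 C0 F0 : hilbertType R}.
Variables (L1 : free_module D C1 F1) (L0 : free_module D C0 F0).
Variables (f : {linear F1 -> F0}) (l : oball R d).

Definition localization (y : C1) : C0 :=
  free_eval L0 (f (free_tensor L1 (da_one D) y)) l.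

Fact localization_is_linear : linear localization.
Proof.
move=> a x y; apply: hdot_inj => v.
by rewrite hdotPl /localization !free_evalE linearPr linearP hdotPl.
Qed.
HB.instance Definition _ := GRing.isLinear.Build R[i] C1 C0 _ localization
  localization_is_linear.

End Localization.

(* The free resolution ... -f 1-> F 1 -f 0-> F 0 -f0-> H -> 0. *)
Definition free_resolution H2 (D : drury_arveson H2) H (M : Ad_module d H)
    (C F : nat -> hilbertType R) (L : forall k, free_module D (C k) (F k))
    (f0 : {linear F 0%N -> H}) (f : forall k, {linear F k.+1 -> F k}) : Prop :=
  [/\ module_hom (L 0%N) M f0 /\ partial_isometry f0,
      forall k, module_hom (L k.+1) (L k) (f k) /\ partial_isometry (f k),
      range f0 = setT,
      range (f 0%N) = [set x | f0 x = 0]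
    & forall k, range (f k.+1) = [set x | f k x = 0]].

Definition mobius (phi : Cn R d -> Cn R d) : Prop :=
  [/\ {within cball R d, continuous phi},
      set_bij (cball R d) (cball R d) phi,
      forall z, oball R d z -> differentiable phi z,
      phi @` oball R d = oball R d
    & phi @` csphere R d = csphere R d].

(* The polynomial 1 - <z, l>. *)
Definition mobius_denom (l : Cn R d) : Apoly R d :=
  1 - \sum_(i < d) cpoly d (l 0 i)^* * zvar R i.

(* M' is the Moebius transform of M by phi, where phi l = 0. *)
Definition mobius_transform (phi : Cn R d -> Cn R d) (l : Cn R d) H
    (M M' : Ad_module d H) : Prop :=
  exists (ell : 'I_d -> Apoly R d) (inv : H -> H),
    [/\ forall i, (msize (ell i) <= 2)%N,
        forall i z, cball R d z -> phi z 0 i = peval (ell i) z / (1 - Cdot z l),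
        cancel (M (mobius_denom l)) inv /\ cancel inv (M (mobius_denom l))
      & forall i x, M' (zvar R i) x = M (ell i) (inv x)].

End Modules.
Arguments drury_arveson {R} d H.

(* The basis of the k-th exterior power of C^d indexed by the sets *)
(* {i_1 < ... < i_k}. *)
Definition ksubset (d k : nat) := {S : {set 'I_d} | #|S| == k}.

Section Koszul.
Context {R : realType} {d : nat} {H : hilbertType R}.
Variable M : Ad_module d H.

Definition koszul_space (k : nat) := {ffun ksubset d k -> H}.

(* x (x) e_{j_1} /\ ... /\ e_{j_k} for T = {j_1 < ... < j_k} *)
Definition koszul_elt (k : nat) (x : H) (T : {set 'I_d}) : koszul_space k :=
  [ffun S => if val S == T then x else 0].

(* The map E_{k+1} -> E_k; if i = i_j in S = {i_1 < ... < i_{k+1}} then j - 1 *)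
(* elements of S are smaller than i. *)
Definition koszul (k : nat) (x : koszul_space k.+1) : koszul_space k :=
  \sum_(S : ksubset d k.+1) \sum_(i in val S)
    koszul_elt k ((-1) ^+ #|[pred j in val S | (j < i)%N]| *: M (zvar R i) (x S))
      (val S :\ i).

Fact koszul_is_linear k : linear (@koszul k).
Proof.
move=> a x y; rewrite /koszul scaler_sumr -big_split; apply: eq_bigr => S _.
rewrite scaler_sumr -big_split; apply: eq_bigr => i _ /=.
apply/ffunP => T; rewrite !ffunE; case: ifP => _; last by rewrite scaler0 addr0.
by rewrite linearP scalerDr !scalerA mulrC.
Qed.
HB.instance Definition _ k := GRing.isLinear.Build R[i] (koszul_space k.+1)
  (koszul_space k) _ (@koszul k) (@koszul_is_linear k).

End Koszul.

(* Main.v *)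
Require Import Defs.
From HB Require Import structures.
From mathcomp Require Import all_boot all_order all_algebra.
From mathcomp Require Import complex.
From mathcomp Require Import ring lra.
From mathcomp Require mpoly.
From mathcomp Require Import all_classical all_reals all_analysis.
Import -(notations) mpoly.

Set Implicit Arguments.
Unset Strict Implicit.
Unset Printing Implicit Defensive.

Import Order.TTheory GRing.Theory Num.Theory.
Import numFieldNormedType.Exports.

Local Open Scope ring_scope.

(** Both homologies are read off from one double complex.  Tensor the sequence
    ... -> F_1 -> F_0 -> H -> 0 with the exterior powers of C^d.  Its rows are
    exact, being sums of copies of the resolution; its columns are the Koszul
    complexes of H, F_0, F_1, ... for the operators ell_i(T), where ell_i is
    the numerator of the i-th coordinate of phi.  Passing from phi^i(T), which
    is ell_i(T) times the inverse of 1 - <T, lambda>, to ell_i(T) changes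
    neither kernels nor images, because the denominator is invertible and
    commutes with everything ([mobius_koszul_homology]).  The column of a free
    module with multiplicity space C_k is a resolution of C_k through the
    evaluation at lambda ([free_exact]), and the evaluation intertwines Phi_k
    with Phi_k(lambda).  A diagram chase along the diagonal of the double
    complex ([double_complex_iso]) then turns the homology of the column of H
    into that of the localized complex.

    The analytic part is the exactness of the columns of free modules.  As phi
    is injective near lambda, the ell_i are linearly independent combinations
    of the z_j - lambda_j ([mobius_numerators]).  Up to an invertible matrix
    and an invertible denominator, they are therefore the coordinates of an
    explicit automorphism of the ball moving lambda to 0.  The kernel
    1 / (1 - <z, w>) is invariant under this automorphism up to a factor
    g(z) conj(g(w)), so its coordinates act on the free module as another d-shift,
    whose origin is lambda ([mobius_shift_model]).

    This leaves the Koszul complex of a d-shift S at the origin.  Write N for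
    the degree.  The adjoint of S_j acts on homogeneous polynomials of degree n
    as the derivative d/dz_j divided by n.  By the rule of Leibniz and Euler's
    identity, the operators (adjoint of S_j) N (N + k)^-1 are the components
    of a contracting homotopy in degree k, just as in the algebraic Koszul
    complex, but bounded ([shift_homotopy], [koszul_tuple_exact]).  The
    operators (N + k)^-1 are obtained algebraically from the fact that the sum
    of the (adjoint of S_j) S_j equals (N + d) (N + 1)^-1
    ([degree_inverse]). *)

Local Notation Re := complex.Re.

(** * Isomorphisms of subquotients *)

Section SubquotientIso.
Context {K : pzRingType}.
Implicit Types U V W : lmodType K.

(** The quotients ZU / BU and ZV / BV are isomorphic.  A diagram chase produces
    a relation between cycles rather than a map, and relations compose without
    choices; the choice is made once, in [subquot_iso_homology]. *)
Definition subquot_iso U V (ZU BU : U -> Prop) (ZV BV : V -> Prop) : Prop :=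
  exists r : U -> V -> Prop,
    [/\ forall a x y x' y', r x y -> r x' y' -> r (a *: x + x') (a *: y + y'),
        forall x, ZU x -> exists2 y, ZV y & r x y,
        forall y, ZV y -> exists2 x, ZU x & r x y
      & forall x y, ZU x -> ZV y -> r x y -> (BU x <-> BV y)].

Lemma subquot_iso_trans U V W (ZU BU : U -> Prop) (ZV BV : V -> Prop)
    (ZW BW : W -> Prop) :
  subquot_iso ZU BU ZV BV -> subquot_iso ZV BV ZW BW ->
  (forall a y y', ZV y -> ZV y' -> ZV (a *: y + y')) ->
  subquot_iso ZU BU ZW BW.
Proof.
move=> [r [rl rU rV rB]] [s [sl sV sW sB]] Zl.
exists (fun x z => exists2 y, ZV y & r x y /\ s y z); split.
- move=> a x z x' z' [y Zy [rxy syz]] [y' Zy' [rxy' syz']].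
  by exists (a *: y + y'); [exact: Zl | split; [exact: rl | exact: sl]].
- move=> x /rU[y Zy rxy]; have [z Zz syz] := sV y Zy.
  by exists z => //; exists y.
- move=> z /sW[y Zy syz]; have [x Zx rxy] := rV y Zy.
  by exists x => //; exists y.
- move=> x z Zx Zz [y Zy [rxy syz]].
  by apply: iff_trans (rB _ _ Zx Zy rxy) (sB _ _ Zy Zz syz).
Qed.

Lemma subquot_iso_sym U V (ZU BU : U -> Prop) (ZV BV : V -> Prop) :
  subquot_iso ZU BU ZV BV -> subquot_iso ZV BV ZU BU.
Proof.
move=> [r [rl rU rV rB]]; exists (fun y x => r x y); split => //.
  by move=> a x y x' y'; apply: rl.
by move=> y x Zy Zx rxy; apply: iff_sym; apply: rB.
Qed.

Lemma subquot_iso_eq U V (ZU BU ZU' BU' : U -> Prop) (ZV BV : V -> Prop) :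
  (forall x, ZU x <-> ZU' x) -> (forall x, BU x <-> BU' x) ->
  subquot_iso ZU BU ZV BV -> subquot_iso ZU' BU' ZV BV.
Proof.
move=> ZE BE [r [rl rU rV rB]]; exists r; split => //.
- by move=> x /ZE/rU.
- by move=> y /rV[x /ZE]; exists x.
- by move=> x y /ZE Zx Zy rxy; apply: iff_trans (rB _ _ Zx Zy rxy); apply: iff_sym.
Qed.

(** The elementary step of a zigzag: in a commutative square, a and b are
    related when they have the same image in the corner M.  In an exact double
    complex, the four predicates are those attached to neighbouring positions
    of a diagonal. *)
Lemma subquot_iso_square (A' A B M : lmodType K)
    (d' : {linear A' -> A}) (v' : {linear A' -> B})
    (v : {linear A -> M}) (d : {linear B -> M}) :
  (forall a, v (d' a) = d (v' a)) ->
  subquot_iso (fun a => exists b, v a = d b)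
    (fun a => exists a1 a2, [/\ a = a1 + a2, exists a', d' a' = a1 & v a2 = 0])
    (fun b => exists a, d b = v a)
    (fun b => exists b1 b2, [/\ b = b1 + b2, d b1 = 0 & exists a', v' a' = b2]).
Proof.
move=> vd; exists (fun a b => v a = d b); split.
- by move=> k a b a' b' ab ab'; rewrite !linearP ab ab'.
- by move=> a [b ab]; exists b => //; exists a.
- by move=> b [a ab]; exists a => //; exists b.
- move=> a b _ _ ab; split.
    move=> [a1 [a2 [aE [a' a'E] va2]]]; exists (b - v' a'), (v' a').
    split; [by rewrite subrK| |by exists a'].
    by rewrite linearB /= -vd a'E -ab aE linearD va2 /= addr0 subrr.
  move=> [b1 [b2 [bE db1 [a' a'E]]]]; exists (d' a'), (a - d' a').
  split; [by rewrite addrC subrK|by exists a'|].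
  by rewrite linearB/= ab vd a'E bE linearD db1/= add0r subrr.
Qed.

(** The ends of a zigzag: along a surjection e, the cycles of M lift to the
    elements of A that e maps to cycles, modulo the kernel of e. *)
Lemma subquot_iso_surj (A' A M' M N : lmodType K)
    (v' : {linear A' -> A}) (v : {linear M' -> M})
    (e' : {linear A' -> M'}) (e : {linear A -> M}) (g : {linear M -> N}) :
  (forall a, e (v' a) = v (e' a)) ->
  (forall m, exists a, e' a = m) -> (forall m, exists a, e a = m) ->
  subquot_iso (fun m => g m = 0) (fun m => exists m', v m' = m)
    (fun a => g (e a) = 0)
    (fun a => exists a1 a2, [/\ a = a1 + a2, e a1 = 0 & exists a', v' a' = a2]).
Proof.
move=> ev se' se; exists (fun m a => m = e a); split.
- by move=> k m a m' a' -> ->; rewrite linearP.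
- by move=> m gm; have [a aE] := se m; exists a; rewrite ?aE.
- by move=> a ga; exists (e a).
- move=> m a _ _ ->; split.
    move=> [m' m'E]; have [a' a'E] := se' m'; exists (a - v' a'), (v' a').
    split; [by rewrite subrK| |by exists a'].
    by rewrite linearB/= ev a'E m'E subrr.
  move=> [a1 [a2 [-> ea1 [a' <-]]]]; exists (e' a').
  by rewrite linearD/= ea1 add0r ev.
Qed.

Local Open Scope quotient_scope.

Lemma homology_pi_eq0 U V W (f : {linear U -> V}) (g : {linear V -> W})
    (x : Defs.kernel g) :
  (\pi_(homology f g) x == 0) = (x \in @im_pred _ _ _ _ f g).
Proof.
have <- : \pi_(homology f g) 0 = 0.
  by apply: (addIr (\pi 0)); rewrite -homology_pi_add addr0 add0r.
by rewrite -Quotient.idealrBE subr0.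
Qed.

Lemma homology_piP U V W (f : {linear U -> V}) (g : {linear V -> W})
    a (x y : Defs.kernel g) :
  \pi_(homology f g) (a *: x + y) =
  a *: \pi_(homology f g) x + \pi_(homology f g) y.
Proof. by rewrite homology_pi_add -homology_scale_pi. Qed.

(** The relation descends to a bijective graph on the quotients: it sends 0 to 0
    and only 0, in both directions, and it is linear. *)
Lemma subquot_iso_homology (U V W U' V' W' : lmodType K)
    (f : {linear U -> V}) (g : {linear V -> W})
    (f' : {linear U' -> V'}) (g' : {linear V' -> W'}) :
  subquot_iso (fun x => g x = 0) (fun x => exists y, f y = x)
    (fun x => g' x = 0) (fun x => exists y, f' y = x) ->
  lin_iso (homology f g) (homology f' g').
Proof.
move=> [r [rl rU rV rB]].
have kerP (x : Defs.kernel g) : g (val x) = 0 by case: x => x /=; rewrite inE => /eqP.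
have kerP' (x : Defs.kernel g') : g' (val x) = 0 by case: x => x /=; rewrite inE => /eqP.
have /choice[h hP] (x : homology f g) : exists y : Defs.kernel g', r (val (repr x)) (val y).
  have [y gy rxy] := rU _ (kerP (repr x)).
  have yk : y \in ker_pred g' by rewrite inE gy.
  by exists (Defs.Kernel yk).
have /choice[k kP] (y : homology f' g') : exists x : Defs.kernel g, r (val x) (val (repr y)).
  have [x gx rxy] := rV _ (kerP' (repr y)).
  have xk : x \in ker_pred g by rewrite inE gx.
  by exists (Defs.Kernel xk).
pose R (x : homology f g) (y : homology f' g') :=
  exists x0 y0, [/\ x = \pi x0, y = \pi y0 & r (val x0) (val y0)].
have RB x y : R x y -> (x = 0 <-> y = 0).
  move=> [x0 [y0 [-> -> rxy]]].
  have E := rB _ _ (kerP x0) (kerP' y0) rxy.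
  split=> /eqP; rewrite !homology_pi_eq0 !inE => H; apply/eqP;
    by rewrite homology_pi_eq0 inE; apply/E.
have Rl a x y x' y' : R x y -> R x' y' -> R (a *: x + x') (a *: y + y').
  move=> [x0 [y0 [-> -> r0]]] [x1 [y1 [-> -> r1]]].
  exists (a *: x0 + x1), (a *: y0 + y1); rewrite !homology_piP; split => //.
  by rewrite !linearP; apply: rl.
pose ph x : homology f' g' := \pi_(homology f' g') (h x).
pose pk y : homology f g := \pi_(homology f g) (k y).
have Rh x : R x (ph x) by exists (repr x), (h x); rewrite reprK.
have Rk y : R (pk y) y by exists (k y), (repr y); rewrite reprK.
have RBl x x' y : R x y -> R x' y -> x = x'.
  move=> Rxy /(Rl (-1) _ _ _ _ Rxy) /RB[_].
  rewrite !scaleN1r addNr => /(_ erefl)/eqP; rewrite addrC subr_eq0.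
  by move=> /eqP.
have RBr x y y' : R x y -> R x y' -> y = y'.
  move=> Rxy /(Rl (-1) _ _ _ _ Rxy) /RB[].
  rewrite !scaleN1r addNr => /(_ erefl)/eqP; rewrite addrC subr_eq0.
  by move=> /eqP.
have ph_lin : linear ph.
  by move=> a x y; apply: (RBr (a *: x + y)) => //; apply: Rl.
pose m := GRing.isLinear.Build K _ _ *:%R ph ph_lin.
pose H : {linear homology f g -> homology f' g'} := HB.pack ph m.
exists H, pk => x; first exact: (RBl _ _ (ph x)).
exact: (RBr (pk x)).
Qed.

End SubquotientIso.

(** * The Koszul complex of a tuple of operators *)

Section KoszulTuple.
From mathcomp Require Import finset.
Context {K : numFieldType} {d : nat} {V : lmodType K}.
Implicit Types (T : {set 'I_d}) (g : {set 'I_d} -> V).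

Definition ksign (i : 'I_d) T : K := (-1) ^+ #|[pred j in T | (j < i)%N]|.

Lemma ksignU (i j : 'I_d) T : i \notin T ->
  ksign j (i |: T) = (-1) ^+ (i < j)%N * ksign j T.
Proof.
move=> iT; rewrite /ksign -exprD; congr (_ ^+ _).
rewrite (cardD1 i) !inE eqxx/=; congr addn.
apply: eq_card => a; rewrite !inE; have [->|//] := eqVneq a i.
by rewrite (negPf iT).
Qed.

Lemma ksignU1 (i : 'I_d) T : i \notin T -> ksign i (i |: T) = ksign i T.
Proof. by move=> iT; rewrite ksignU// ltnn mul1r. Qed.

Lemma ksign_sqr (i : 'I_d) T : ksign i T * ksign i T = 1.
Proof. by rewrite -expr2 sqrr_sign. Qed.

Lemma ksign_swap (i j : 'I_d) T : i != j -> i \notin T -> j \in T ->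
  ksign i T * ksign j (i |: T) = - (ksign j T * ksign i (T :\ j)).
Proof.
move=> ij iT jT; rewrite ksignU//.
rewrite -[in ksign i T](setD1K jT) ksignU ?setD11//.
have : ((i < j) + (j < i) = 1)%N by move: ij; rewrite -val_eqE/=; case: ltngtP.
case: (i < j)%N; case: (j < i)%N => // _; rewrite ?expr0 ?expr1; ring.
Qed.

(** Working with all subsets at once, instead of those of a fixed size, avoids
    dependent types: an element of degree k is a function supported on the
    subsets of size k.  The coboundary multiplies by e_j on the left. *)
Definition kbound (a : 'I_d -> {linear V -> V}) g T : V :=
  \sum_(i | i \notin T) ksign i T *: a i (g (i |: T)).
Definition kcobound (b : 'I_d -> {linear V -> V}) g T : V :=
  \sum_(j in T) ksign j T *: b j (g (T :\ j)).

(** The terms removing i and j in the two possible orders cancel. *)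
Lemma kbound_kbound (a : 'I_d -> {linear V -> V}) g T :
  (forall i j x, a i (a j x) = a j (a i x)) -> kbound a (kbound a g) T = 0.
Proof.
move=> aC; pose F i j := if (i \notin T) && (j \notin i |: T) then
  (ksign i T * ksign j (i |: T)) *: a i (a j (g (j |: (i |: T)))) else 0.
have FN i j : F i j = - F j i.
  rewrite /F !inE !negb_or [j == i]eq_sym.
  have [ij|ij] := eqVneq i j; rewrite ?andbF/= ?oppr0//.
  rewrite andbC; case: ifP => [/andP[jT iT]|_]; last by rewrite oppr0.
  rewrite -scaleNr (aC i j) setUCA; congr (_ *: _).
  rewrite !ksignU//.
  have : ((i < j) + (j < i) = 1)%N by move: ij; rewrite -val_eqE/=; case: ltngtP.
  case: (i < j)%N; case: (j < i)%N => // _; rewrite ?expr0 ?expr1; ring.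
have -> : kbound a (kbound a g) T = \sum_i \sum_j F i j.
  rewrite /kbound big_mkcond; apply: eq_bigr => i _; rewrite /F.
  case: ifP => iT; last by rewrite big1.
  rewrite linear_sum scaler_sumr/= big_mkcond/=; apply: eq_bigr => j _.
  by case: ifP => // _; rewrite linearZ scalerA.
have E : \sum_i \sum_j F i j = - \sum_i \sum_j F i j.
  rewrite [in RHS]exchange_big/= -sumrN; apply: eq_bigr => i _.
  by rewrite -sumrN; apply: eq_bigr => j _; rewrite FN.
apply/eqP; move/eqP: E; rewrite -addr_eq0 -mulr2n -scaler_nat scaler_eq0.
by rewrite pnatr_eq0.
Qed.

(** By the anticommutation of contraction by e_i and multiplication by e_j, the
    terms with i <> j cancel as soon as the operators commute, so that only the
    diagonal terms remain.  There are no such terms on the full set. *)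
Lemma kbound_kcobound (S G G' : 'I_d -> {linear V -> V}) g T :
  (T != [set: 'I_d] -> forall i j x, i != j -> G' j (S i x) = S i (G j x)) ->
  kbound S (kcobound G g) T + kcobound G' (kbound S g) T =
  \sum_(i | i \notin T) S i (G i (g T)) + \sum_(j in T) G' j (S j (g T)).
Proof.
move=> GS.
have -> : kbound S (kcobound G g) T = \sum_(i | i \notin T) S i (G i (g T)) +
    \sum_(i | i \notin T) \sum_(j in T)
      (ksign i T * ksign j (i |: T)) *: S i (G j (g ((i |: T) :\ j))).
  rewrite -big_split; apply: eq_bigr => i iT /=.
  rewrite /kcobound (bigD1 i) ?setU11//= linearD scalerDr.
  rewrite linearZ scalerA ksignU1// ksign_sqr scale1r setU1K//; congr (_ + _).
  rewrite linear_sum scaler_sumr/=; apply: eq_big => [j|j _].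
    rewrite !inE; have [->|//] := eqVneq j i; last by rewrite andbT.
    by rewrite (negPf iT).
  by rewrite linearZ/= scalerA.
have -> : kcobound G' (kbound S g) T = \sum_(j in T) G' j (S j (g T)) +
    \sum_(j in T) \sum_(i | i \notin T)
      (ksign j T * ksign i (T :\ j)) *: G' j (S i (g (i |: (T :\ j)))).
  rewrite -big_split; apply: eq_bigr => j jT /=.
  rewrite /kbound (bigD1 j) ?setD11//= linearD scalerDr.
  rewrite linearZ scalerA setD1K// -[in ksign j T](setD1K jT) ksignU1 ?setD11//.
  rewrite ksign_sqr scale1r; congr (_ + _).
  rewrite linear_sum scaler_sumr/=; apply: eq_big => [i|i _].
    by rewrite !inE negb_and negbK; have [->|] := eqVneq i j; rewrite ?jT ?andbT.
  by rewrite linearZ/= scalerA.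
rewrite addrACA -[RHS]addr0; congr (_ + _).
rewrite [X in _ + X]exchange_big/= -big_split big1// => i iT /=.
rewrite -big_split big1// => j jT /=.
have ij : i != j by apply: contraNneq iT => ->.
rewrite GS//; last by apply: contraNneq iT => ->; rewrite inE.
rewrite setDUl (_ : [set i] :\ j = [set i]); last first.
  by apply/setP => a; rewrite !inE; case: eqVneq => [->|]; rewrite ?andbT// eq_sym (negPf ij).
by rewrite ksign_swap// -scalerDl addNr scale0r.
Qed.

(** The default value 0 makes [kextend] the inclusion of degree k. *)
Definition kextend k (x : {ffun ksubset d k -> V}) T : V :=
  if insub T is Some t then x t else 0.
Definition krestrict k g : {ffun ksubset d k -> V} := [ffun T => g (val T)].

Lemma kextendE k (x : {ffun ksubset d k -> V}) (T : ksubset d k) :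
  kextend x (val T) = x T.
Proof. by rewrite /kextend valK. Qed.

Lemma kextend_out k (x : {ffun ksubset d k -> V}) T : #|T| != k -> kextend x T = 0.
Proof. by move=> Tk; rewrite /kextend insubN. Qed.

Lemma krestrictK k g : (forall T, #|T| != k -> g T = 0) ->
  kextend (krestrict k g) =1 g.
Proof.
move=> gk T; have [Tk|Tk] := boolP (#|T| == k); last by rewrite kextend_out// gk.
by rewrite -[T]/(val (exist _ T Tk : ksubset d k)) kextendE ffunE.
Qed.

Lemma eq_kbound a g g' : g =1 g' -> kbound a g =1 kbound a g'.
Proof. by move=> gg T; apply: eq_bigr => i _; rewrite gg. Qed.

Lemma kextend_linear k a (x y : {ffun ksubset d k -> V}) T :
  kextend (a *: x + y) T = a *: kextend x T + kextend y T.
Proof.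
by rewrite /kextend; case: insubP => [t _ _|_]; rewrite ?ffunE// scaler0 addr0.
Qed.

Variable a : 'I_d -> {linear V -> V}.

Definition koszul_tuple k (x : {ffun ksubset d k.+1 -> V}) : {ffun ksubset d k -> V} :=
  krestrict k (kbound a (kextend x)).

Fact koszul_tuple_is_linear k : linear (@koszul_tuple k).
Proof.
move=> c x y; apply/ffunP => T; rewrite !ffunE /kbound scaler_sumr -big_split.
apply: eq_bigr => i _ /=.
by rewrite kextend_linear linearP scalerDr !scalerA mulrC.
Qed.
HB.instance Definition _ k := GRing.isLinear.Build K _ _ _ (@koszul_tuple k)
  (@koszul_tuple_is_linear k).

Lemma kextend_koszul k (x : {ffun ksubset d k.+1 -> V}) :
  kextend (koszul_tuple x) =1 kbound a (kextend x).
Proof.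
apply: krestrictK => T Tk; rewrite /kbound big1// => i iT.
by rewrite kextend_out ?linear0 ?scaler0// cardsU1 iT eqSS.
Qed.

Lemma koszul_tuple2 k (x : {ffun ksubset d k.+2 -> V}) :
  (forall i j x, a i (a j x) = a j (a i x)) -> koszul_tuple (koszul_tuple x) = 0.
Proof.
move=> aC; apply/ffunP => T; rewrite !ffunE.
by rewrite (eq_kbound _ (@kextend_koszul _ x)) kbound_kbound.
Qed.

(** The homotopy is the coboundary with coefficients G from degree k+1 to k+2 and
    with coefficients G' from degree k to k+1; the second hypothesis says that
    the diagonal terms of [kbound_kcobound] add up to the identity.  Cross terms,
    hence the commutation hypothesis, only occur below the top degree. *)
Lemma koszul_tuple_exact k (G G' : 'I_d -> {linear V -> V}) :
  ((k.+1 < d)%N -> forall i j x, i != j -> G' j (a i x) = a i (G j x)) ->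
  (forall T x, #|T| = k.+1 ->
    \sum_(i | i \notin T) a i (G i x) + \sum_(j in T) G' j (a j x) = x) ->
  forall x : {ffun ksubset d k.+1 -> V}, koszul_tuple x = 0 ->
    exists y : {ffun ksubset d k.+2 -> V}, koszul_tuple y = x.
Proof.
move=> GS hom x x0; exists (krestrict k.+2 (kcobound G (kextend x))).
apply/ffunP => T; rewrite ffunE.
rewrite (eq_kbound _ (krestrictK _)); last first.
  move=> U Uk; rewrite /kcobound big1// => j jU; rewrite kextend_out ?linear0 ?scaler0//.
  by apply: contra Uk => /eqP Uj; rewrite (cardsD1 j) jU Uj.
have Tk : #|val T| = k.+1 by apply/eqP; case: T.
have := @kbound_kcobound a G G' (kextend x) (val T).
rewrite hom// kextendE => <-.
  rewrite [X in _ + X]big1 ?addr0// => j jT.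
  by rewrite -kextend_koszul x0 /kextend; case: insub => [t|]; rewrite ?ffunE linear0 scaler0.
move=> TT; apply: GS; rewrite -Tk -[X in (_ < X)%N]card_ord -cardsT.
by apply: proper_card; rewrite properT.
Qed.

End KoszulTuple.

Section KoszulModule.
From mathcomp Require Import finset.

Lemma koszulE (R : realType) (d : nat) (H : hilbertType R) (M : Ad_module d H) k
    (x : koszul_space k.+1) :
  koszul M x = koszul_tuple (fun i => M (zvar R i)) x.
Proof.
apply/ffunP => T; rewrite ffunE sum_ffunE.
under eq_bigr do rewrite sum_ffunE (big_mkcond (fun i => i \in _)).
rewrite exchange_big/= /kbound [RHS]big_mkcond; apply: eq_bigr => i _.
case: ifP => iT; last first.
  rewrite big1// => S _; case: ifP => // iS; rewrite ffunE; case: eqP => // TE.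
  by move: iT; rewrite TE setD11.
have Uk : #|i |: val T| == k.+1 by rewrite cardsU1 iT (eqP (valP T)).
pose U : ksubset d k.+1 := exist _ (i |: val T) Uk.
rewrite (bigD1 U)//= setU11 ffunE setU1K// eqxx -/(ksign i (val U)) /= ksignU1//.
rewrite -[i |: val T]/(val U) kextendE big1 ?addr0// => S SU.
case: ifP => // iS; rewrite ffunE; case: eqP => // TE.
by move: SU; rewrite -val_eqE /= TE setD1K// eqxx.
Qed.

End KoszulModule.

Section KoszulNaturality.
Context {K : numFieldType} {d : nat}.
Implicit Types U V W : lmodType K.

(** The tensor product of h with the identity of the k-th exterior power. *)
Definition ffun_map V W (h : {linear V -> W}) k (x : {ffun ksubset d k -> V}) :
  {ffun ksubset d k -> W} := [ffun T => h (x T)].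

Fact ffun_map_is_linear V W (h : {linear V -> W}) k : linear (@ffun_map V W h k).
Proof. by move=> a x y; apply/ffunP => T; rewrite !ffunE linearP. Qed.
HB.instance Definition _ V W (h : {linear V -> W}) k :=
  GRing.isLinear.Build K _ _ _ (@ffun_map V W h k) (@ffun_map_is_linear V W h k).

Lemma kextend_map V W (h : {linear V -> W}) k (x : {ffun ksubset d k -> V}) T :
  kextend (ffun_map h x) T = h (kextend x T).
Proof. by rewrite /kextend; case: insub => [t|]; rewrite ?ffunE// linear0. Qed.

Lemma koszul_tuple_map V W (a : 'I_d -> {linear V -> V}) (b : 'I_d -> {linear W -> W})
    (h : {linear V -> W}) k (x : {ffun ksubset d k.+1 -> V}) :
  (forall i y, h (a i y) = b i (h y)) ->
  koszul_tuple b (ffun_map h x) = ffun_map h (koszul_tuple a x).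
Proof.
move=> hab; apply/ffunP => T; rewrite !ffunE /kbound linear_sum.
by apply: eq_bigr => i _; rewrite kextend_map linearZ/= hab.
Qed.

Lemma koszul_tuple_comp V (a b : 'I_d -> {linear V -> V}) (h : {linear V -> V}) k
    (x : {ffun ksubset d k.+1 -> V}) :
  (forall i y, b i y = a i (h y)) -> koszul_tuple b x = koszul_tuple a (ffun_map h x).
Proof.
move=> bah; apply/ffunP => T; rewrite !ffunE /kbound.
by apply: eq_bigr => i _; rewrite kextend_map bah.
Qed.

Lemma ffun_map_exact U V W (f : {linear U -> V}) (g : {linear V -> W}) k
    (x : {ffun ksubset d k -> V}) :
  (forall v, g v = 0 -> exists u, f u = v) -> ffun_map g x = 0 ->
  exists y, ffun_map f y = x.
Proof.
move=> fg gx; have /choice[y yP] T : exists u, f u = x T.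
  by apply: fg; move/ffunP: gx => /(_ T); rewrite !ffunE.
by exists [ffun T => y T]; apply/ffunP => T; rewrite !ffunE.
Qed.

End KoszulNaturality.

(** * Hilbert spaces: Riesz representation and adjoints *)

Section HilbertAPI.
Context {R : realType}.
Implicit Types H : hilbertType R.

Lemma hdotC H (x y : H) : hdot y x = (hdot x y)^*.
Proof. by rewrite hermC expr0 mul1r. Qed.
Lemma hdot0l H (y : H) : hdot 0 y = 0. Proof. exact: linear0l. Qed.
Lemma hdot0r H (x : H) : hdot x 0 = 0. Proof. exact: linear0r. Qed.
Lemma hdotDl H (x y z : H) : hdot (x + y) z = hdot x z + hdot y z.
Proof. exact: linearDl. Qed.
Lemma hdotDr H (x y z : H) : hdot x (y + z) = hdot x y + hdot x z.
Proof. exact: linearDr. Qed.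
Lemma hdotBl H (x y z : H) : hdot (x - y) z = hdot x z - hdot y z.
Proof. exact: linearBl. Qed.
Lemma hdotBr H (x y z : H) : hdot x (y - z) = hdot x y - hdot x z.
Proof. exact: linearBr. Qed.
Lemma hdotNl H (x y : H) : hdot (- x) y = - hdot x y.
Proof. exact: linearNl. Qed.
Lemma hdotZl H a (x y : H) : hdot (a *: x) y = a * hdot x y.
Proof. exact: linearZl_LR. Qed.
Lemma hdotZr H a (x y : H) : hdot x (a *: y) = a^* * hdot x y.
Proof. exact: linearZr_LR. Qed.
Lemma hdot_suml H I r (P : pred I) (F : I -> H) y :
  hdot (\sum_(i <- r | P i) F i) y = \sum_(i <- r | P i) hdot (F i) y.
Proof. exact: linear_sumlz. Qed.
Lemma hdot_sumr H I r (P : pred I) (F : I -> H) x :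
  hdot x (\sum_(i <- r | P i) F i) = \sum_(i <- r | P i) hdot x (F i).
Proof. exact: linear_sumr. Qed.
Lemma hdot_injr H (x y : H) : (forall z, hdot z x = hdot z y) -> x = y.
Proof. by move=> xy; apply: hdot_inj => z; rewrite hdotC xy -hdotC. Qed.

Lemma ge0_RRe (x : R[i]) : 0 <= x -> x = (Re x)%:C%C.
Proof. by move=> x0; rewrite RRe_real// ger0_real. Qed.

Lemma Re_ge0 (x : R[i]) : 0 <= x -> 0 <= Re x.
Proof. by move=> x0; rewrite -lecR -ge0_RRe. Qed.

(** Estimates are carried out in R, on the real Hilbert space underlying H,
    because R[i] is only partially ordered. *)
Definition sqn H (x : H) : R := Re (hdot x x).
Definition rdot H (x y : H) : R := Re (hdot x y).

Lemma sqnE H (x : H) : (sqn x)%:C%C = `|x| ^+ 2.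
Proof. by rewrite -ge0_RRe ?hdot_norm// exprn_ge0. Qed.

Lemma sqn_ge0 H (x : H) : 0 <= sqn x.
Proof. by rewrite -lecR sqnE exprn_ge0. Qed.

Lemma rdotC H (x y : H) : rdot x y = rdot y x.
Proof. by rewrite /rdot hdotC; case: (hdot y x). Qed.

Lemma sqnD H (x y : H) : sqn (x + y) = sqn x + rdot x y *+ 2 + sqn y.
Proof.
rewrite /sqn hdotDl !hdotDr !raddfD/= -!/(rdot _ _) (rdotC y x) mulr2n.
by rewrite !addrA.
Qed.

Lemma rdotDl H (x y z : H) : rdot (x + y) z = rdot x z + rdot y z.
Proof. by rewrite /rdot hdotDl raddfD. Qed.

Lemma rdotZl H (a : R) (x y : H) : rdot (a%:C%C *: x) y = a * rdot x y.
Proof. by rewrite /rdot hdotZl; case: (hdot x y) => u v /=; rewrite mul0r subr0. Qed.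

Lemma sqnZ H (a : R) (x : H) : sqn (a%:C%C *: x) = a ^+ 2 * sqn x.
Proof.
by rewrite -!/(rdot x x) /sqn -!/(rdot _ _) rdotZl rdotC rdotZl mulrA.
Qed.

Lemma sqnN H (x : H) : sqn (- x) = sqn x.
Proof. by rewrite /sqn hnormN. Qed.

Lemma rdotNr H (x y : H) : rdot x (- y) = - rdot x y.
Proof. by rewrite rdotC /rdot hdotNl raddfN -!/(rdot _ _) rdotC. Qed.

Lemma quad_discr (a b c : R) : 0 <= a -> 0 <= c ->
  (forall t, 0 <= a * t ^+ 2 + b *+ 2 * t + c) -> b ^+ 2 <= a * c.
Proof.
move=> a0 c0 h; have [a00|an0] := eqVneq a 0.
  rewrite a00 mul0r; have [->|bn0] := eqVneq b 0; first by rewrite expr0n.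
  have := h (- (c + 1) / (b * 2)).
  have -> : b *+ 2 * (- (c + 1) / (b * 2)) = - (c + 1) by field.
  by move=> k; exfalso; move: k; rewrite a00 mul0r; lra.
have ap : 0 < a by rewrite lt_def an0.
have := h (- b / a).
have -> : a * (- b / a) ^+ 2 + b *+ 2 * (- b / a) + c = (a * c - b ^+ 2) / a by field.
by rewrite pmulr_lge0 ?invr_gt0// subr_ge0.
Qed.

Lemma CS_rdot H (x y : H) : rdot x y ^+ 2 <= sqn x * sqn y.
Proof.
apply: quad_discr; rewrite ?sqn_ge0// => t.
have := sqn_ge0 (t%:C%C *: x + y); rewrite sqnD sqnZ rdotZl.
by lra.
Qed.

Lemma CS_hdot H (x y : H) : `|hdot x y| <= `|x| * `|y|.
Proof.
have [->|dn0] := eqVneq (hdot x y) 0; first by rewrite normr0 mulr_ge0.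
pose a := (hdot x y)^*.
have h := CS_rdot (a *: x) y.
have h2 : (rdot (a *: x) y)%:C%C = `|hdot x y| ^+ 2.
  by rewrite /rdot hdotZl -ge0_RRe /a mulrC -normCK// exprn_ge0.
move: h; rewrite -lecR rmorphXn rmorphM/= h2 !sqnE normrZ /a norm_conjC.
have dp : 0 < `|hdot x y| by rewrite normr_gt0.
rewrite -exprMn ler_pXn2r ?nnegrE ?mulr_ge0 ?exprn_ge0// expr2 -mulrA.
by rewrite ler_pM2l.
Qed.

Lemma sqn_complete H (x : nat -> H) :
  (forall e, 0 < e -> exists N, forall n m, (N <= n)%N -> (N <= m)%N ->
    sqn (x n - x m) < e) ->
  exists y, forall e, 0 < e -> exists N, forall n, (N <= n)%N -> sqn (x n - y) < e.
Proof.
move=> xC.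
have sq_lt (a : H) (e : R[i]) : 0 < e -> sqn a < Re e ^+ 2 -> `|a| < e.
  move=> e0; rewrite -ltcR sqnE rmorphXn/= -ge0_RRe ?ltW//.
  by rewrite ltr_pXn2r ?nnegrE ?(ltW e0).
have Re_gt0 (e : R[i]) : 0 < e -> 0 < Re e.
  by move=> e0; rewrite -ltcR -ge0_RRe ?ltW.
have : cvgn x.
  apply/cauchy_cvgP/cauchy_ballP => e e0; near_simpl.
  have [N xN] := xC (Re e ^+ 2) (exprn_gt0 _ (Re_gt0 _ e0)).
  near=> n m => /=; rewrite -ball_normE /=; apply: sq_lt => //.
  by apply: xN; [near: n|near: m]; exists N.
move=> /cvg_ex[y /cvgrPdist_lt xy]; exists y => e e0.
have s0 : 0 < (Num.sqrt e)%:C%C :> R[i] by rewrite ltcR sqrtr_gt0.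
have [N _ yN] := xy _ s0; exists N => n /yN/=.
rewrite -ltcR sqnE distrC => lt; rewrite -(sqr_sqrtr (ltW e0)) rmorphXn.
by rewrite ltr_pXn2r ?nnegrE// ltW.
Unshelve. all: by end_near. Qed.

(** The representing vector is the minimizer of J x = |x|^2 - 2 Re (phi x).  By
    the parallelogram identity a minimizing sequence is Cauchy, and the first
    variation of J at its limit y vanishes, which is Re (phi z) = Re <z, y>.
    Replacing z by i z gives the imaginary parts. *)
Theorem riesz H (phi : {linear H -> R[i]^o}) (c : R[i]) : 0 <= c ->
  (forall x, `|phi x| <= c * `|x|) -> exists y, forall x, phi x = hdot x y.
Proof.
move=> c0 phic.
pose f x := Re (phi x).
have fD x y : f (x + y) = f x + f y by rewrite /f !raddfD.
have fZ (a : R) x : f (a%:C%C *: x) = a * f x.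
  by rewrite /f linearZ/= /GRing.scale/=; case: (phi x) => u v /=; rewrite mul0r subr0.
have fk x : f x ^+ 2 <= Re c ^+ 2 * sqn x.
  rewrite -lecR [leRHS]rmorphM/= sqnE [(Re c ^+ 2)%:C%C]rmorphXn/= -ge0_RRe// -exprMn.
  apply: le_trans (_ : `|phi x| ^+ 2 <= _); last first.
    by rewrite ler_pXn2r ?nnegrE ?mulr_ge0.
  rewrite -(real_normK (num_real (f x))) rmorphXn ler_pXn2r ?nnegrE//.
    exact: normc_ge_Re.
  by rewrite lecR.
pose J x := sqn x - f x *+ 2.
have Jlb x : - Re c ^+ 2 <= J x.
  have : 0 <= (sqn x) by exact: sqn_ge0.
  move: (fk x); rewrite /J; set q := sqn x; set a := f x; set b := Re c => h q0.
  have := sqr_ge0 (q - b ^+ 2); have: 0 <= b ^+ 2 by exact: sqr_ge0.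
  move=> b0 h2.
  have : (a *+ 2) ^+ 2 <= (q + b ^+ 2) ^+ 2 by lra.
  have qb : 0 <= q + b ^+ 2 by lra.
  rewrite -ler_sqrt ?sqr_ge0// !sqrtr_sqr (ger0_norm qb) ler_norml => /andP[_ ?].
  by lra.
pose m := inf (range J).
have hJ : has_inf (range J).
  split; first by exists (J 0); exists 0.
  by exists (- Re c ^+ 2) => _ [x _ <-].
have Jm x : m <= J x by apply: ge_inf; [case: hJ|exists x].
have near_min (e : R) : 0 < e -> exists x, J x < m + e.
  by move=> /(inf_adherent)/(_ hJ)[_ [x _ <-]]; exists x.
have /choice[x xm] (n : nat) : exists x, J x < m + n.+1%:R^-1.
  by apply: near_min; rewrite invr_gt0.
(* the value of J at the midpoint is at least m *)
have par a b : sqn (a - b) <= (J a - m + (J b - m)) *+ 2.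
  have := Jm ((2^-1)%:C%C *: (a + b)).
  rewrite /J sqnZ fZ fD !sqnD sqnN.
  rewrite rdotNr.
  by lra.
have inv_small (e : R) : 0 < e -> exists N, forall n, (N <= n)%N -> n.+1%:R^-1 < e.
  move=> e0; exists (Num.truncn e^-1) => n Nn.
  rewrite invf_plt ?posrE//.
  rewrite (lt_le_trans (truncnS_gt _))// ler_nat ltnS //.
have [y xy] : exists y, forall e, 0 < e -> exists N, forall n, (N <= n)%N -> sqn (x n - y) < e.
  apply: sqn_complete => e e0.
  have e4 : 0 < e / 4 by lra.
  have [N small] := inv_small _ e4; exists N.
  move=> n p Nn Np; have h1 := small n Nn; have h2 := small p Np.
  have h3 := par (x n) (x p); have h4 := xm n; have h5 := xm p.
  by move: h1 h2 h3 h4 h5; move: (J _) (J _) (sqn _) n.+1%:R^-1 p.+1%:R^-1 => a b q r t; lra.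
(* the polynomial t |-> J (x n + t z) - J (x n) + 1 / (n+1) is nonnegative *)
have first_order n z : (rdot (x n) z - f z) ^+ 2 <= n.+1%:R^-1 * sqn z.
  rewrite mulrC; apply: quad_discr; rewrite ?sqn_ge0 ?invr_ge0// => t.
  have := Jm (x n + t%:C%C *: z); move: (xm n); rewrite /J.
  rewrite sqnD sqnZ fD fZ rdotC rdotZl rdotC.
  by move: n.+1%:R^-1 => r; lra.
have re_eq z : f z = Re (hdot z y).
  rewrite -/(rdot z y) rdotC; apply/eqP; rewrite eq_sym.
  rewrite -subr_eq0 -sqrf_eq0 eq_le sqr_ge0 andbT.
  apply/ler_addgt0Pr => e e0; rewrite add0r.
  pose q := sqn z + 1.
  have q0 : 0 < q by have := sqn_ge0 z; rewrite /q; lra.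
  have d0 : 0 < e / (4 * q) by rewrite divr_gt0 ?mulr_gt0.
  have [N1 h1] := inv_small _ d0; have [N2 h2] := xy _ d0.
  pose n := maxn N1 N2.
  have {}h1 := h1 n (leq_maxl _ _); have {}h2 := h2 n (leq_maxr _ _).
  have A : (rdot (x n) z - f z) ^+ 2 <= e / (4 * q) * q.
    apply: le_trans (first_order n z) _; apply: ler_pM => //; rewrite ?sqn_ge0 ?invr_ge0 ?ltW//.
    by rewrite /q ltrDl.
  have B : rdot (x n - y) z ^+ 2 <= e / (4 * q) * q.
    apply: le_trans (CS_rdot _ _) _; apply: ler_pM => //; rewrite ?sqn_ge0 ?ltW//.
    by rewrite /q ltrDl.
  have E4 : e / (4 * q) * q = e / 4 by field; rewrite gt_eqF.
  rewrite E4 in A B.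
  have -> : rdot y z = rdot (x n) z - rdot (x n - y) z.
    by rewrite rdotDl /rdot hdotNl raddfN/=; lra.
  have := sqr_ge0 (rdot (x n) z - f z + rdot (x n - y) z).
  by lra.
exists y => z; apply/eqP; rewrite eq_complex -/(f z) re_eq eqxx/=.
have := re_eq ('i%C *: z); rewrite /f linearZ/= hdotZl /GRing.scale/=.
case: (phi z) => a b; case: (hdot z y) => a' b' /=.
by rewrite !mul0r !mul1r !sub0r => /oppr_inj->.
Qed.

(** Packs a linear function; operators obtained by choice are plain functions. *)
Lemma linear_exists (K : pzRingType) (U V : lmodType K) (g : U -> V) :
  linear g -> exists h : {linear U -> V}, h =1 g.
Proof.
move=> lin_g; pose m := GRing.isLinear.Build K U V *:%R g lin_g.
pose h : {linear U -> V} := HB.pack g m.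
by exists h.
Qed.

Lemma adjoint_exists (H K : hilbertType R) (S : {linear H -> K}) (c : R[i]) :
  0 <= c -> (forall x, `|S x| <= c * `|x|) ->
  exists S' : {linear K -> H}, forall x y, hdot (S x) y = hdot x (S' y).
Proof.
move=> c0 Sc.
have /choice[g gS] (y : K) : exists z, forall x, hdot (S x) y = hdot x z.
  have lin_phi : linear (fun x => hdot (S x) y : R[i]^o).
    by move=> a u v; rewrite linearP hdotDl hdotZl.
  have [phi phiE] := linear_exists lin_phi.
  have [|x|z zE] := @riesz H phi (c * `|y|); first by rewrite mulr_ge0.
    by rewrite phiE (le_trans (CS_hdot _ _))// mulrAC ler_wpM2r.
  by exists z => x; rewrite -zE phiE.
have [S' S'E] : exists S' : {linear K -> H}, S' =1 g.
  apply: linear_exists => a u v; apply: hdot_injr => z.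
  by rewrite -gS hdotDr hdotZr !gS hdotDr hdotZr.
by exists S' => x y; rewrite S'E.
Qed.

Lemma expr_small (r : R) : 0 <= r -> r < 1 -> forall e, 0 < e ->
  exists N, forall n, (N <= n)%N -> r ^+ n < e.
Proof.
move=> r0 r1 e e0.
have /cvgrPdist_lt/(_ e e0)[N _ rN] : ((fun n => r ^+ n) @ \oo --> (0 : R))%classic.
  by apply: cvg_expr; rewrite ger0_norm.
exists N => n /rN/=; rewrite sub0r normrN ger0_norm//.
exact: exprn_ge0.
Qed.

(** The Neumann series, as the fixed point iteration x |-> y + X x. *)
Lemma sub_contraction_bij H (X : {linear H -> H}) (q : R[i]) :
  0 <= q -> q < 1 -> (forall x, `|X x| <= q * `|x|) ->
  exists Z : {linear H -> H},
    cancel (fun x => x - X x) Z /\ cancel Z (fun x => x - X x).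
Proof.
move=> q0 q1 Xq.
have q10 : 0 < 1 - q by rewrite subr_gt0.
have inj x : x = X x -> x = 0.
  move=> xX; apply/eqP; rewrite -normr_eq0; apply/negPn/negP => n0.
  have := Xq x; rewrite -xX -[leLHS]mul1r -subr_le0 -mulrBl.
  by rewrite pmulr_rle0// normr_le0 -normr_eq0 (negPf n0).
have surj y : exists x, x - X x = y.
  pose x n := iter n (fun z => y + X z) 0.
  have xB n : `|x n| <= `|y| / (1 - q).
    elim: n => [|n IH]; first by rewrite normr0 divr_ge0// ltW.
    rewrite (le_trans (ler_normD _ _))// (le_trans (lerD (lexx _) (Xq _)))//.
    rewrite (le_trans (lerD (lexx _) (ler_wpM2l q0 IH)))//.
    by rewrite le_eqVlt; apply/orP; left; apply/eqP; field; rewrite gt_eqF.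
  (* x (n + k) - x n is the n-th iterate of X at x k *)
  have xD k n : `|x (n + k)%N - x n| <= q ^+ n * (`|y| / (1 - q)).
    elim: n => [|n IH]; first by rewrite subr0 expr0 mul1r.
    rewrite addSn /= opprD addrACA subrr add0r -linearB.
    by rewrite (le_trans (Xq _))// exprS -mulrA ler_wpM2l.
  pose B := Re (`|y| / (1 - q)).
  have B0 : 0 <= `|y| / (1 - q) by rewrite divr_ge0// ltW.
  have BE : B%:C%C = `|y| / (1 - q) by rewrite -ge0_RRe.
  pose r := Re q; have rE : r%:C%C = q by rewrite -ge0_RRe.
  have r0 : 0 <= r by exact: Re_ge0.
  have r1 : r < 1 by rewrite -ltcR rE.
  have rr1 : r ^+ 2 < 1 by rewrite expr_lt1.
  have sqD k n : sqn (x (n + k)%N - x n) <= (r ^+ 2) ^+ n * B ^+ 2.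
    rewrite -lecR sqnE -exprM mulnC exprM -exprMn rmorphXn rmorphM rmorphXn/= rE BE.
    have ? : 0 <= q ^+ n * (`|y| / (1 - q)) by rewrite mulr_ge0// exprn_ge0.
    by rewrite ler_pXn2r ?nnegrE.
  have small (e : R) : 0 < e -> exists N, forall n k, (N <= n)%N -> sqn (x (n + k)%N - x n) < e.
    move=> e0; have e0' : 0 < e / (B ^+ 2 + 1) by rewrite divr_gt0// ltr_wpDl ?sqr_ge0.
    have [N NP] := expr_small (sqr_ge0 r) rr1 e0'; exists N => n k /NP h.
    apply: le_lt_trans (sqD k n) _.
    rewrite ltr_pdivlMr ?ltr_wpDl ?sqr_ge0// in h; apply: le_lt_trans h.
    by rewrite ler_wpM2l ?exprn_ge0 ?sqr_ge0// lerDl.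
  have [z zP] : exists z, forall e, 0 < e -> exists N, forall n, (N <= n)%N -> sqn (x n - z) < e.
    apply: sqn_complete => e e0; have [N NP] := small e e0; exists N => n m Nn Nm.
    case: (leqP n m) => [nm|/ltnW mn].
      by rewrite -sqnN opprB -(subnKC nm); apply: NP.
    by rewrite -(subnKC mn); apply: NP.
  exists z; apply/eqP; rewrite -subr_eq0 -normr_eq0 -sqrf_eq0 -sqnE.
  suff : sqn (z - X z - y) <= 0.
    by move=> le0; rewrite eq_le -[0]/(0%:C%C) !lecR le0 sqn_ge0.
  apply/ler_addgt0Pr => e e0; rewrite add0r.
  have e4 : 0 < e / 4 by lra.
  have [N NP] := zP _ e4.
  have sqX a : sqn (X a) <= sqn a.
    rewrite -lecR !sqnE ler_pXn2r ?nnegrE// (le_trans (Xq _))//.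
    by rewrite ler_piMl// ltW.
  have sqD2 (a b : H) : sqn (a + b) <= (sqn a + sqn b) *+ 2.
    by have := sqn_ge0 (a - b); rewrite !sqnD sqnN rdotNr; lra.
  have -> : z - X z - y = - (x N.+1 - z) + X (x N - z).
    rewrite -[x N.+1]/(y + X (x N)) [X (_ - _)]linearB opprB opprD !addrA subrK addrAC //.
  apply: le_trans (sqD2 _ _) _; rewrite sqnN.
  have := NP N (leqnn _); have := NP N.+1 (leqnSn _); have := sqX (x N - z).
  by move: (sqn _) (sqn _) (sqn _) => a b c; lra.
have /choice[Z ZP] := surj.
have XB x y : x - X x = y - X y -> x = y.
  move=> xy; apply/subr0_eq/inj; rewrite [X (_ - _)]linearB; apply/subr0_eq.
  by rewrite opprD addrACA -opprD xy subrr.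
have [Z' Z'E] : exists Z' : {linear H -> H}, Z' =1 Z.
  apply: linear_exists => a u v; apply: XB; rewrite ZP linearP opprD addrACA !ZP.
  by rewrite -scalerBr ZP.
by exists Z'; split=> x; rewrite Z'E ?ZP//; apply: XB; rewrite ZP.
Qed.
End HilbertAPI.

Section Adjointable.
Context {R : realType} {F : hilbertType R}.
Implicit Types A B : F -> F.

(** Two adjointable operators that agree on a family with trivial orthogonal
    complement are equal: this replaces continuity and density of a span.
    Such operators are automatically linear. *)
Definition adjointable A := exists A', forall x y, hdot (A x) y = hdot x (A' y).

Lemma adjointable_linear A : adjointable A -> linear A.
Proof.
by move=> [A' AA'] a x y; apply: hdot_inj => z; rewrite hdotPl !AA' hdotPl.
Qed.

Lemma adjointable_id : adjointable id. Proof. by exists id. Qed.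

Lemma adjointable_comp A B : adjointable A -> adjointable B -> adjointable (A \o B).
Proof.
by move=> [A' AA'] [B' BB']; exists (B' \o A') => x y /=; rewrite AA' BB'.
Qed.

Lemma adjointable_scale a A : adjointable A -> adjointable (fun x => a *: A x).
Proof.
move=> [A' AA']; exists (fun y => a^* *: A' y) => x y.
by rewrite hdotZl hdotZr conjCK AA'.
Qed.

Lemma adjointable_add A B :
  adjointable A -> adjointable B -> adjointable (fun x => A x + B x).
Proof.
move=> [A' AA'] [B' BB']; exists (fun y => A' y + B' y) => x y.
by rewrite hdotDl hdotDr AA' BB'.
Qed.

Lemma adjointable_opp A : adjointable A -> adjointable (fun x => - A x).
Proof.
by move=> /(adjointable_scale (-1)); under eq_fun do rewrite scaleN1r.
Qed.

Lemma adjointable_sum I (r : seq I) (A : I -> F -> F) :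
  (forall i, adjointable (A i)) -> adjointable (fun x => \sum_(i <- r) A i x).
Proof.
move=> Aa; elim: r => [|i r IH].
  by exists (fun=> 0) => x y; rewrite big_nil hdot0l hdot0r.
under eq_fun do rewrite big_cons.
exact: adjointable_add.
Qed.

End Adjointable.

Section Inequalities.
Context {R : realType}.

Lemma CS_sum (I : finType) (b y : I -> R) :
  (\sum_i b i * y i) ^+ 2 <= (\sum_i b i ^+ 2) * (\sum_i y i ^+ 2).
Proof.
apply: quad_discr; try by apply: sumr_ge0 => i _; exact: sqr_ge0.
move=> t; have : 0 <= \sum_i (b i * t + y i) ^+ 2 by apply: sumr_ge0 => i _; exact: sqr_ge0.
congr (0 <= _); rewrite mulr_suml -sumrMnl mulr_suml -!big_split.
by apply: eq_bigr => i _ /=; ring.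
Qed.

(** By 2 |<w, v>| <= |w|^2 + |v|^2 < 2. *)
Lemma Cdot_neq1 (d : nat) (v w : Cn R d) : oball R d v -> oball R d w ->
  1 - Cdot w v != 0.
Proof.
move=> vB wB; rewrite subr_eq0; apply/negP => /eqP E.
have : `|Cdot w v| *+ 2 <= Csqnorm w + Csqnorm v.
  rewrite /Csqnorm -big_split /=.
  apply: le_trans (_ : \sum_i (`|w 0 i| * `|v 0 i|) *+ 2 <= _).
    rewrite sumrMnl ler_wMn2r// (le_trans (ler_norm_sum _ _ _))//.
    by apply: ler_sum => i _; rewrite normrM norm_conjC.
  apply: ler_sum => i _; rewrite -subr_ge0.
  have -> : `|w 0 i| ^+ 2 + `|v 0 i| ^+ 2 - (`|w 0 i| * `|v 0 i|) *+ 2 =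
    (`|w 0 i| - `|v 0 i|) ^+ 2 by ring.
  by rewrite -realEsqr rpredB ?normr_real.
by rewrite -E normr1 mulr2n => /le_lt_trans/(_ (ltrD wB vB)); rewrite ltxx.
Qed.

Lemma eq0_of_small (c B s0 : R[i]) : 0 < s0 -> 0 <= B ->
  (forall s, 0 < s -> s <= s0 -> `|c| <= s * B) -> c = 0.
Proof.
move=> s00 B0 cB; apply/eqP; rewrite -normr_eq0; apply/negPn/negP => cn0.
have c0 : 0 < `|c| by rewrite lt_def cn0 /=.
have D0 : 0 < `|c| + s0 * (B + 1) by rewrite ltr_wpDr// mulr_ge0 ?addr_ge0// ltW.
pose s := s0 * `|c| / (`|c| + s0 * (B + 1)).
have sp : 0 < s by rewrite divr_gt0// mulr_gt0.
have ss0 : s <= s0.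
  by rewrite ler_pdivrMr// ler_pM2l// lerDl mulr_ge0 ?addr_ge0// ltW.
have /(le_lt_trans (cB s sp ss0)) : s * B < `|c|; last by rewrite ltxx.
rewrite mulrAC ltr_pdivrMr// -subr_gt0.
rewrite (_ : _ - _ = `|c| * `|c| + `|c| * s0); last by ring.
by rewrite addr_gt0// mulr_gt0.
Qed.

Lemma poly_eq_eval (P Q : {poly R[i]}) : (forall x, P.[x] = Q.[x]) -> P = Q.
Proof.
move=> PQ; apply/eqP; rewrite -subr_eq0; apply/eqP.
apply: (@roots_geq_poly_eq0 _ _ [seq n%:R | n <- iota 0 (size (P - Q))]).
- by apply/allP => x _; rewrite rootE !hornerE PQ subrr.
- by rewrite map_inj_uniq ?iota_uniq// => m n /eqP; rewrite eqr_nat => /eqP.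
- by rewrite size_map size_iota.
Qed.

End Inequalities.

(** * Models of the d-shift *)

(** F is H_d^2 (x) C up to unitary equivalence, S the multiplication by the
    coordinates, e v y the kernel function k_v (x) y and ev0 the evaluation at
    0.  This leaves out the actual functions on the ball, so that the same space
    can carry several such structures, one for each automorphism. *)
Record shift_model (R : realType) (d : nat) (C F : hilbertType R)
    (S : 'I_d -> {linear F -> F}) (e : Cn R d -> C -> F)
    (ev0 : F -> C) : Prop := ShiftModel {
  shift_bounded : exists2 c, 0 <= c & forall i x, `|S i x| <= c * `|x| ;
  shift_eval : forall i x v y, oball R d v ->
    hdot (S i x) (e v y) = v 0 i * hdot x (e v y) ;
  shift_gram : forall v w y z, oball R d v -> oball R d w ->
    hdot (e v y) (e w z) = hdot y z / (1 - Cdot w v) ;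
  shift_total : forall x, (forall v y, oball R d v -> hdot x (e v y) = 0) -> x = 0 ;
  shift_ev0 : forall x y, hdot x (e 0 y) = hdot (ev0 x) y
}.

Section ShiftModel.
Context {R : realType} {d : nat} {C F : hilbertType R}.
Context {S : 'I_d -> {linear F -> F}} {e : Cn R d -> C -> F} {ev0 : F -> C}.
Hypothesis model : shift_model S e ev0.
Local Notation ball := (oball R d).
Implicit Types (v w : Cn R d) (x : F) (a : 'I_d -> R[i]) (i j : 'I_d) (n m : nat).

Let ball0 : ball 0. Proof. by have := @oball0_subproof R d; rewrite inE. Qed.

Lemma shift_inj x y : (forall v z, ball v -> hdot x (e v z) = hdot y (e v z)) -> x = y.
Proof.
move=> xy; apply/subr0_eq/(shift_total model) => v z vB.
by rewrite hdotBl xy// subrr.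
Qed.

Lemma shift_comm i j x : S i (S j x) = S j (S i x).
Proof. by apply: shift_inj => v z vB; rewrite !(shift_eval model)// mulrCA. Qed.

(** The linear form with coefficients a, evaluated at S. *)
Definition comb a x := \sum_i a i *: S i x.

Fact comb_is_linear a : linear (comb a).
Proof.
move=> k x y; rewrite /comb scaler_sumr -big_split; apply: eq_bigr => i _ /=.
by rewrite linearP scalerDr !scalerA mulrC.
Qed.
HB.instance Definition _ a := GRing.isLinear.Build _ _ _ _ (comb a) (comb_is_linear a).

Lemma comb_shift a i x : comb a (S i x) = S i (comb a x).
Proof.
by rewrite /comb linear_sum; apply: eq_bigr => j _; rewrite linearZ/= shift_comm.
Qed.

Definition vconj v i : R[i] := (v 0 i)^*.

(** This is k_v = (1 - <S, v>)^-1 1, with the inverse cleared. *)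
Lemma e_resolvent v y : ball v -> e v y = e 0 y + comb (vconj v) (e v y).
Proof.
move=> vB; apply: shift_inj => w z wB.
rewrite hdotDl /comb hdot_suml.
under eq_bigr do rewrite hdotZl (shift_eval model)// mulrA.
rewrite -mulr_suml !(shift_gram model)//.
have -> : Cdot w 0 = 0 by rewrite /Cdot big1// => i _; rewrite mxE conjC0 mulr0.
have -> : \sum_i vconj v i * w 0 i = Cdot w v by apply: eq_bigr => i _; rewrite mulrC.
by have := Cdot_neq1 vB wB; move: (Cdot w v) => t t0; field.
Qed.

Lemma shift_adjoint : exists Sa : 'I_d -> {linear F -> F},
  forall i x y, hdot (S i x) y = hdot x (Sa i y).
Proof.
have [c c0 Sc] := shift_bounded model.
have /choice[T TE] i : exists T : {linear F -> F}, forall x y, hdot (S i x) y = hdot x (T y).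
  exact: (adjoint_exists c0).
by exists T.
Qed.

Definition Sa : 'I_d -> {linear F -> F} := sval (cid shift_adjoint).
Lemma SaE i x y : hdot (S i x) y = hdot x (Sa i y).
Proof. by rewrite /Sa; case: cid. Qed.
Lemma SaEr i x y : hdot (Sa i x) y = hdot x (S i y).
Proof. by rewrite hdotC -SaE -hdotC. Qed.

Lemma Sa_e i v y : ball v -> Sa i (e v y) = vconj v i *: e v y.
Proof.
by move=> vB; apply: hdot_injr => x; rewrite -SaE (shift_eval model)// hdotZr conjCK.
Qed.

(** The defect of the row contraction (S_1, ..., S_d) is the projection onto the
    constants; it suffices to check this on kernel functions, where [Sa] is
    scalar. *)
Lemma sum_S_Sa x : \sum_i S i (Sa i x) = x - e 0 (ev0 x).
Proof.
apply: shift_inj => v z vB; rewrite hdot_suml.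
under eq_bigr do rewrite SaE SaEr Sa_e// linearZ/=.
rewrite -hdot_sumr -/(comb (vconj v) (e v z)).
have -> : comb (vconj v) (e v z) = e v z - e 0 z by rewrite [in RHS]e_resolvent// addrC addKr.
rewrite hdotBl hdotBr (shift_ev0 model) (shift_gram model)//.
have -> : Cdot v 0 = 0 by rewrite /Cdot big1// => i _; rewrite mxE conjC0 mulr0.
by rewrite subr0 divr1.
Qed.

(** Gleason's problem at the origin: an element vanishing at 0 lies in the range
    of the row (S_1, ..., S_d). *)
Lemma ev0_ideal x : ev0 x = 0 -> x = \sum_i S i (Sa i x).
Proof.
move=> x0; rewrite sum_S_Sa x0; apply/eqP; rewrite eq_sym subr_eq addrC -subr_eq subrr eq_sym.
by apply/eqP/shift_inj => v z vB; rewrite (shift_gram model)// !hdot0l mul0r.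
Qed.

Lemma sum_sqr_Sa x : \sum_i `|Sa i x| ^+ 2 <= `|x| ^+ 2.
Proof.
under eq_bigr do rewrite -hdot_norm SaEr.
rewrite -hdot_sumr sum_S_Sa hdotBr (shift_ev0 model) !hdot_norm.
by rewrite gerBl exprn_ge0.
Qed.

(** The adjoint of the row (S_1, ..., S_d) is a contraction by [sum_sqr_Sa], hence so
    is the row. *)
Lemma comb_bound a x : `|comb a x| ^+ 2 <= (\sum_i `|a i| ^+ 2) * `|x| ^+ 2.
Proof.
set z := comb a x; have [->|zn0] := eqVneq z 0.
  by rewrite normr0 expr0n mulr_ge0 ?sumr_ge0// => *; rewrite exprn_ge0.
have z0 : 0 < `|z| by rewrite normr_gt0.
pose b i := Re `|a i|; pose y i := Re `|Sa i z|.
have bE i : (b i)%:C%C = `|a i| by rewrite -ge0_RRe.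
have yE i : (y i)%:C%C = `|Sa i z| by rewrite -ge0_RRe.
have A : `|z| ^+ 2 <= `|x| * \sum_i `|a i| * `|Sa i z|.
  rewrite -hdot_norm {1}/z hdot_suml.
  apply: le_trans (_ : `|\sum_i hdot (a i *: S i x) z| <= _).
    have <- : hdot z z = \sum_i hdot (a i *: S i x) z by rewrite {1}/z hdot_suml.
    by rewrite hdot_norm real_ler_norm// realX// normr_real.
  rewrite (le_trans (ler_norm_sum _ _ _))// mulr_sumr ler_sum// => i _.
  by rewrite hdotZl SaE normrM mulrCA ler_wpM2l// CS_hdot.
have B : (\sum_i `|a i| * `|Sa i z|) ^+ 2 <= (\sum_i `|a i| ^+ 2) * `|z| ^+ 2.
  apply: le_trans (_ : (\sum_i `|a i| ^+ 2) * \sum_i `|Sa i z| ^+ 2 <= _); last first.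
    by rewrite ler_wpM2l ?sum_sqr_Sa// sumr_ge0// => *; rewrite exprn_ge0.
  have := CS_sum b y; rewrite -lecR rmorphXn rmorphM !rmorph_sum/=.
  under eq_bigr do rewrite rmorphM/= bE yE.
  under [X in _ <= X * _ -> _]eq_bigr do rewrite rmorphXn/= bE.
  by under [X in _ <= _ * X -> _]eq_bigr do rewrite rmorphXn/= yE.
have s0 : 0 <= \sum_i `|a i| * `|Sa i z| by rewrite sumr_ge0// => *; rewrite mulr_ge0.
have : (`|z| ^+ 2) ^+ 2 <= (\sum_i `|a i| ^+ 2) * `|x| ^+ 2 * `|z| ^+ 2.
  apply: le_trans (_ : (`|x| * \sum_i `|a i| * `|Sa i z|) ^+ 2 <= _).
    by rewrite ler_pXn2r ?nnegrE ?exprn_ge0 ?mulr_ge0.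
  by rewrite exprMn [leRHS]mulrAC [leRHS]mulrC ler_wpM2l// exprn_ge0.
by rewrite [X in X <= _]expr2 ler_pM2r// exprn_gt0.
Qed.

(** The n-th power of a linear form.  These powers span the homogeneous
    polynomials of degree n, so they replace monomials without any multi-index
    combinatorics. *)
Definition u a n y := iter n (comb a) (e 0 y).

(** The kernel function at v is the sum of the powers of the linear form <., v>;
    the series converges because the row is contractive and |v| < 1. *)
Lemma u_total x : (forall a n y, hdot x (u a n y) = 0) -> x = 0.
Proof.
move=> xu; apply: (shift_total model) => v y vB.
have xN n : hdot x (e v y) = hdot x (iter n (comb (vconj v)) (e v y)).
  elim: n => [//|n IH]; rewrite IH {1}(e_resolvent _ vB).
  have -> (w : F) : iter n (comb (vconj v)) (e 0 y + w) =
      u (vconj v) n y + iter n (comb (vconj v)) w.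
    by rewrite /u; elim: n {IH} => //= n ->; rewrite linearD.
  by rewrite hdotDr xu add0r -iterSr.
pose q := Csqnorm v.
have q0 : 0 <= q by apply: sumr_ge0 => i _; rewrite exprn_ge0.
have qN n : `|iter n (comb (vconj v)) (e v y)| ^+ 2 <= q ^+ n * `|e v y| ^+ 2.
  elim: n => [|n IH]; first by rewrite mul1r.
  rewrite (le_trans (comb_bound _ _))// [q ^+ n.+1]exprS -mulrA.
  rewrite (_ : \sum_i _ = q); last by apply: eq_bigr => i _; rewrite norm_conjC.
  by rewrite ler_wpM2l.
apply/eqP; rewrite -normr_eq0 -sqrf_eq0 eq_le exprn_ge0// andbT.
have h n : `|hdot x (e v y)| ^+ 2 <= q ^+ n * (`|x| * `|e v y|) ^+ 2.
  rewrite (xN n) exprMn mulrCA.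
  rewrite (le_trans (_ : _ <= (`|x| * `|iter n (comb (vconj v)) (e v y)|) ^+ 2))//.
    by rewrite ler_pXn2r ?nnegrE ?mulr_ge0// CS_hdot.
  by rewrite exprMn ler_wpM2l// exprn_ge0.
have r1 : Re q < 1 by rewrite -ltcR -ge0_RRe.
pose B := Re ((`|x| * `|e v y|) ^+ 2).
have B0 : 0 <= B by rewrite Re_ge0// exprn_ge0// mulr_ge0.
have BE : B%:C%C = (`|x| * `|e v y|) ^+ 2 by rewrite -ge0_RRe// exprn_ge0// mulr_ge0.
have dE : (Re (`|hdot x (e v y)| ^+ 2))%:C%C = `|hdot x (e v y)| ^+ 2.
  by rewrite -ge0_RRe// exprn_ge0.
rewrite -dE -[0]/(0%:C%C) lecR.
apply/ler_addgt0Pr => t t0; rewrite add0r.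
have t0' : 0 < t / (B + 1) by rewrite divr_gt0// ltr_wpDl.
have [n nP] := expr_small (Re_ge0 q0) r1 t0'.
have qE : q ^+ n * (`|x| * `|e v y|) ^+ 2 = (Re q ^+ n * B)%:C%C.
  by rewrite rmorphM rmorphXn/= BE -ge0_RRe.
have := h n; rewrite -dE qE lecR => /le_trans; apply.
have := nP n (leqnn _); rewrite ltr_pdivlMr ?ltr_wpDl// => /ltW; apply: le_trans.
by rewrite ler_wpM2l ?exprn_ge0 ?Re_ge0// lerDl.
Qed.

Lemma hdot_e0_shift i x y : hdot (e 0 y) (S i x) = 0.
Proof.
by rewrite hdotC (shift_eval model)// mxE mul0r conjC0.
Qed.

Lemma Sa_u0 i a y : Sa i (u a 0 y) = 0.
Proof. by apply: hdot_inj => z; rewrite SaEr hdot_e0_shift hdot0l. Qed.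

Lemma comb_le a : exists2 p, 0 <= p & forall x, `|comb a x| <= p * `|x|.
Proof.
have [c c0 Sc] := shift_bounded model.
exists ((\sum_i `|a i|) * c); first by rewrite mulr_ge0// sumr_ge0.
move=> x; rewrite (le_trans (ler_norm_sum _ _ _))// -mulrA mulr_suml ler_sum// => i _.
by rewrite normrZ ler_wpM2l.
Qed.

(** The adjoint of S_i multiplies the kernel function at v by the conjugate of
    v_i.  At the points v whose conjugate is s a, for s > 0 small, the kernel
    function is the sum over n of the s^n u a n y, and the claim compares the
    coefficients of s^(n+1).  Remainders take the place of the infinite sum:
    that of order k is s^k times the k-th iterate of comb a at the kernel
    function, and the statement Q k equates the remainders of both sides;
    letting s tend to 0 in Q k gives the coefficient of order k+1, and Q (k+1)
    is what is left after division by s. *)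
Lemma Sa_uS i a n y : Sa i (u a n.+1 y) = a i *: u a n y.
Proof.
have [p p0 ap] := comb_le a.
pose A := \sum_i `|a i| ^+ 2.
have A0 : 0 <= A by rewrite sumr_ge0// => *; rewrite exprn_ge0.
(* s <= s0 ensures |v s| < 1, and s p <= 1/2, which bounds the kernel at v s *)
pose s0 := (1 + A + p *+ 2)^-1.
have D0 : 0 < 1 + A + p *+ 2 by rewrite -addrA ltr_pwDl// addr_ge0// mulrn_wge0.
have s00 : 0 < s0 by rewrite invr_gt0.
pose small s := (0 < s) && (s <= s0).
pose v s : Cn R d := \row_j (s * (a j)^*).
have sconj s : small s -> s^* = s by move=> /andP[s1 _]; rewrite conj_Creal// ger0_real// ltW.
have vcE s : small s -> vconj (v s) =1 (fun j => s * a j).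
  by move=> ss j; rewrite /vconj mxE rmorphM/= conjCK sconj.
have combE s x : small s -> comb (vconj (v s)) x = s *: comb a x.
  move=> ss; rewrite /comb scaler_sumr; apply: eq_bigr => j _.
  by rewrite vcE// scalerA.
have sA s : small s -> s * (1 + A + p *+ 2) <= 1.
  by move=> /andP[_ ss]; rewrite -ler_pdivlMr// mul1r.
have s1 s : small s -> s <= 1.
  move=> ss; apply: le_trans (sA s ss); rewrite -[leLHS]mulr1.
  have /andP[sp _] := ss; rewrite ler_pM2l// -addrA lerDl addr_ge0// mulrn_wge0//.
have vB s : small s -> ball (v s).
  move=> ss; have /andP[sp _] := ss; rewrite /ball/= /Csqnorm.
  have -> : \sum_i `|v s 0 i| ^+ 2 = s * (s * A).
    rewrite /A !mulr_sumr; apply: eq_bigr => j _.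
    by rewrite mxE normrM norm_conjC exprMn ger0_norm ?ltW// expr2 mulrA.
  apply: le_lt_trans (_ : s * A < 1).
    by rewrite ler_pM2l// ler_piMl// s1.
  apply: lt_le_trans (sA s ss); rewrite ltr_pM2l// [1 + A]addrC -addrA ltrDl.
  by rewrite ltr_pwDl// mulrn_wge0.
have eB s z : small s -> `|e (v s) z| <= `|e 0 z| *+ 2.
  move=> ss; have /andP[sp _] := ss.
  have : `|e (v s) z| <= `|e 0 z| + s * p * `|e (v s) z|.
    rewrite {1}(e_resolvent _ (vB s ss)) (le_trans (ler_normD _ _))// lerD2l.
    by rewrite combE// normrZ gtr0_norm// -mulrA ler_wpM2l// ltW.
  have sp2 : s * p *+ 2 <= 1.
    apply: le_trans (sA s ss); rewrite -mulrnAr ler_pM2l// lerDr addr_ge0//.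
  move: `|e (v s) z| `|e 0 z| (normr_ge0 (e (v s) z)) => E E0 E00 h.
  have : E *+ 2 <= E0 *+ 2 + E.
    apply: le_trans (_ : (E0 + s * p * E) *+ 2 <= _); first by rewrite ler_wMn2r.
    by rewrite mulrnDl lerD2l -mulrnAl ler_piMl.
  by rewrite [E *+ 2]mulr2n lerD2r.
have iterB k s z : small s -> `|iter k (comb a) (e (v s) z)| <= p ^+ k * (`|e 0 z| *+ 2).
  move=> ss; elim: k => [|k IH]; first by rewrite mul1r eB.
  by rewrite (le_trans (ap _))// exprS -mulrA ler_wpM2l.
apply: hdot_inj => z; rewrite SaEr hdotZl.
pose Q k := forall s, small s ->
  hdot (iter k.+1 (comb a) (e (v s) y)) (S i z) = a i * hdot (iter k (comb a) (e (v s) y)) z.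
have Qe k s : small s -> iter k (comb a) (e (v s) y) =
  u a k y + s *: iter k.+1 (comb a) (e (v s) y).
  move=> ss; rewrite {1}(e_resolvent _ (vB s ss)) combE//.
  have -> (w : F) : iter k (comb a) (e 0 y + w) = u a k y + iter k (comb a) w.
    by rewrite /u; elim: k => //= k ->; rewrite linearD.
  congr (_ + _); rewrite iterSr; move: (comb a (e (v s) y)) => w.
  by elim: k => //= k ->; rewrite linearZ.
have Q0 : Q 0%N.
  move=> s ss; have /andP[sp _] := ss.
  have sn0 : s != 0 by rewrite gt_eqF.
  apply: (mulfI sn0); rewrite /= -[s * hdot _ _]hdotZl.
  have -> : s *: comb a (e (v s) y) = - u a 0 y + e (v s) y.
    by rewrite -[in RHS]/(iter 0 (comb a) (e (v s) y)) (Qe 0%N s ss) addKr.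
  rewrite hdotDl hdotNl hdot_e0_shift oppr0 add0r hdotC (shift_eval model); last exact: vB.
  by rewrite rmorphM/= -hdotC mxE rmorphM/= conjCK sconj// mulrA.
have step k : Q k -> hdot (u a k.+1 y) (S i z) = a i * hdot (u a k y) z /\ Q k.+1.
  move=> Qk.
  pose D s := hdot (iter k.+2 (comb a) (e (v s) y)) (S i z) -
    a i * hdot (iter k.+1 (comb a) (e (v s) y)) z.
  have E : forall s, small s -> hdot (u a k.+1 y) (S i z) - a i * hdot (u a k y) z = - (s * D s).
    move=> s ss; have := Qk _ ss; rewrite (Qe k.+1 s ss) (Qe k s ss) !hdotDl !hdotZl /D => h.
    apply/eqP; rewrite -subr_eq0 opprK; apply/eqP.
    pose c := hdot (iter k.+1 (comb a) (e (v s) y)) z.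
    rewrite -[RHS](subrr (a i * (hdot (u a k y) z + s * c))).
    by rewrite -{1}h; ring.
  have c0 : hdot (u a k.+1 y) (S i z) - a i * hdot (u a k y) z = 0.
    pose B := p ^+ k.+2 * (`|e 0 y| *+ 2) * `|S i z| +
      `|a i| * (p ^+ k.+1 * (`|e 0 y| *+ 2) * `|z|).
    apply: (@eq0_of_small _ _ B s0) => //.
      have e0 : 0 <= `|e 0 y| *+ 2 by rewrite mulrn_wge0.
      have h m : 0 <= p ^+ m * (`|e 0 y| *+ 2) := mulr_ge0 (exprn_ge0 _ p0) e0.
      by apply: addr_ge0; [exact: mulr_ge0 | apply: mulr_ge0 => //; exact: mulr_ge0].
    move=> s sp ss0; have ss : small s by rewrite /small sp.
    rewrite (E s ss) normrN normrM gtr0_norm// ler_pM2l// (le_trans (ler_normB _ _))// lerD//.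
      by rewrite (le_trans (CS_hdot _ _))// ler_wpM2r// iterB.
    by rewrite normrM ler_wpM2l// (le_trans (CS_hdot _ _))// ler_wpM2r// iterB.
  split; first exact: subr0_eq.
  move=> s ss; have := E s ss; rewrite c0 => /esym/eqP; rewrite oppr_eq0 mulf_eq0.
  by have /andP[sp _] := ss; rewrite gt_eqF//= => /eqP/subr0_eq.
have QA k : Q k by elim: k => // k /step[].
by have [] := step n (QA n).
Qed.

Lemma u_swap a n i y : comb a (S i (u a n y)) = S i (u a n.+1 y).
Proof. exact: comb_shift. Qed.

(** Moving a in the direction e_i differentiates u a n y into n S_i u a (n-1) y;
    this polarization extends statements about powers of linear forms to
    the products S_i u a n y. *)
Definition bump_coef a i (t : R[i]) j : R[i] := a j + t * (i == j)%:R.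

Lemma comb_bump a i t x : comb (bump_coef a i t) x = comb a x + t *: S i x.
Proof.
rewrite /comb; under eq_bigr do rewrite scalerDl.
rewrite big_split/=; congr (_ + _); rewrite (bigD1 i)//= eqxx mulr1.
by rewrite big1 ?addr0// => j; rewrite eq_sym => /negPf->; rewrite mulr0 scale0r.
Qed.

(** Only the coefficients of degree 0 and 1 in t matter, as they are the value and
    the derivative at t = 0.  For n = 0 the predecessor is harmless, the
    coefficient of degree 1 being multiplied by 0. *)
Lemma u_bump_poly a i n y z : exists P : {poly R[i]},
  [/\ forall t, hdot (u (bump_coef a i t) n y) z = P.[t],
      P`_0 = hdot (u a n y) z
    & P`_1 = n%:R * hdot (S i (u a n.-1 y)) z].
Proof.
elim: n z => [|n IH] z.
  exists (hdot (e 0 y) z)%:P; split => [t||]; rewrite ?hornerC ?coefC//=.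
  by rewrite mul0r.
have [P [PE P0 P1]] := IH (\sum_j (a j)^* *: Sa j z).
have combE x : hdot (comb a x) z = hdot x (\sum_j (a j)^* *: Sa j z).
  rewrite hdot_suml hdot_sumr; apply: eq_bigr => j _.
  by rewrite hdotZl hdotZr SaE conjCK.
have [Q [QE Q0 Q1]] := IH (Sa i z).
exists (P + 'X * Q); split => [t||].
- by rewrite /= comb_bump hdotDl hdotZl combE SaE PE QE !hornerE.
- by rewrite coefD coefXM/= addr0 P0 -combE.
- rewrite coefD coefXM/= Q0 P1 -SaE -combE.
  case: n {IH P P0 P1 PE Q Q0 Q1 QE} => [|n]; first by rewrite mul0r add0r mul1r.
  by rewrite /= u_swap -[in RHS]addn1 natrD mulrDl mul1r.
Qed.

(** The rule of Leibniz d/dz_j (z_i p) = delta_ij p + z_i dp/dz_j for p = u a n y,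
    obtained by differentiating [Sa_uS] in the direction e_i. *)
Lemma Sa_S_u i j a n y :
  n.+1%:R *: Sa j (S i (u a n y)) =
  (i == j)%:R *: u a n y + (n%:R * a j) *: S i (u a n.-1 y).
Proof.
apply: hdot_inj => z; rewrite hdotDl !hdotZl SaEr.
have [P [PE P0 P1]] := u_bump_poly a i n.+1 y (S j z).
have [Q [QE Q0 Q1]] := u_bump_poly a i n y z.
have PQ : P = ((a j)%:P + (i == j)%:R *: 'X) * Q.
  apply: poly_eq_eval => t; rewrite -PE -SaEr Sa_uS hdotZl QE !hornerE.
  by rewrite /bump_coef [t * _]mulrC.
rewrite -[LHS]P1 PQ mulrDl coefD coefCM -scalerAl coefZ coefXM/= Q0 Q1.
by rewrite addrC mulrCA mulrA.
Qed.

(** An operator acting on each degree as a scalar on powers of linear forms also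
    does so on their multiples by coordinates, by polarization. *)
Lemma diag_shift (K : F -> F) (k : nat -> R[i]) : adjointable K ->
  (forall a n y, K (u a n y) = k n *: u a n y) ->
  forall i a n y, K (S i (u a n y)) = k n.+1 *: S i (u a n y).
Proof.
move=> [K' KK'] Ku i a n y; apply: hdot_inj => z.
apply/eqP; rewrite -subr_eq0 KK' hdotZl.
have -> x : k n.+1 * hdot x z = hdot x ((k n.+1)^* *: z) by rewrite hdotZr conjCK.
rewrite -hdotBr.
have [P [PE _ P1]] := u_bump_poly a i n.+1 y (K' z - (k n.+1)^* *: z).
have P0 : P = 0.
  apply: poly_eq_eval => t; rewrite -PE hdotBr hdotZr conjCK -KK' Ku hdotZl.
  by rewrite subrr hornerC.
move: P1; rewrite P0 coef0 => /esym/eqP; rewrite mulf_eq0 pnatr_eq0/=.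
by [].
Qed.

Lemma eq_on_u A B : adjointable A -> adjointable B ->
  (forall a n y, A (u a n y) = B (u a n y)) -> A =1 B.
Proof.
move=> [A' AA'] [B' BB'] AB x; apply: hdot_inj => z; rewrite AA' BB'.
have -> // : A' z = B' z; apply/subr0_eq/u_total => a n y.
by rewrite hdotC hdotBr -AA' -BB' AB subrr conjC0.
Qed.

Lemma adj_S i : adjointable (S i). Proof. by exists (Sa i); apply: SaE. Qed.
Lemma adj_Sa i : adjointable (Sa i). Proof. by exists (S i); apply: SaEr. Qed.

Lemma Sa_S_uE i j a n y : Sa j (S i (u a n y)) =
  n.+1%:R^-1 *: ((i == j)%:R *: u a n y + (n%:R * a j) *: S i (u a n.-1 y)).
Proof. by rewrite -Sa_S_u scalerA mulVf ?scale1r// pnatr_eq0. Qed.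

(** Euler's identity for u a n y. *)
Lemma comb_u a n y : \sum_j (n%:R * a j) *: S j (u a n.-1 y) = n%:R *: u a n y.
Proof.
case: n => [|n]; first by rewrite scale0r big1// => j _; rewrite mul0r scale0r.
by rewrite /u /= /comb scaler_sumr; apply: eq_bigr => j _; rewrite scalerA.
Qed.

Lemma sum_Sa_S_u a n y :
  \sum_i Sa i (S i (u a n y)) = ((n + d)%:R / n.+1%:R) *: u a n y.
Proof.
under eq_bigr do rewrite Sa_S_uE eqxx scale1r.
rewrite -scaler_sumr big_split/= comb_u sumr_const card_ord -[_ *+ d]scaler_nat -scalerDl.
by rewrite scalerA mulrC natrD [n%:R + _]addrC.
Qed.

(** The operator (N + k)^-1.  The sum W of the (adjoint of S_j) S_j equals
    (N + d) / (N + 1), which gives (N + 1)^-1 = (W - 1) / (d - 1).  Conjugation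
    of (N + k)^-1 by S, that is the sum of the (adjoint of S_j) (N + k)^-1 S_j,
    equals (N + d) / ((N + 1) (N + k + 1)), which is
    ((d - 1) / k) (N + 1)^-1 + ((k + 1 - d) / k) (N + k + 1)^-1.
    This can be solved for (N + k + 1)^-1 as long as k + 1 < d. *)
Lemma degree_inverse k : (0 < k < d)%N -> exists2 K, adjointable K &
  forall a n y, K (u a n y) = (n + k)%:R^-1 *: u a n y.
Proof.
have adjW A : adjointable A -> adjointable (fun x => \sum_j Sa j (A (S j x))).
  move=> Aa; apply: adjointable_sum => j.
  exact: (adjointable_comp (adj_Sa j) (adjointable_comp Aa (adj_S j))).
have [d1|d1] := leqP d 1; first by case: k => [//|k]; rewrite ltnS ltnNge (leq_trans d1).
have natn (m : nat) : m.+1%:R != 0 :> R[i] by rewrite pnatr_eq0.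
have [K1 K1a K1E] : exists2 K, adjointable K &
    forall a n y, K (u a n y) = n.+1%:R^-1 *: u a n y.
  exists (fun x => (d.-1)%:R^-1 *: (\sum_j Sa j (S j x) - x)).
    apply: adjointable_scale; apply: adjointable_add; first exact: (adjW id adjointable_id).
    exact: adjointable_opp adjointable_id.
  move=> a n y; rewrite sum_Sa_S_u -{2}[u a n y]scale1r -scalerBl scalerA.
  congr (_ *: _).
  have dE : d%:R = d.-1%:R + 1 :> R[i] by rewrite natr1 prednK// ltnW.
  have dn0 : d.-1%:R != 0 :> R[i] by rewrite pnatr_eq0 -lt0n -ltnS prednK// ltnW.
  have := natn n; rewrite natrD dE -natr1; move: dn0.
  by move: (d.-1%:R : R[i]) (n%:R : R[i]) => D N D0 N0; field; rewrite D0 N0.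
elim: k => [//|k IH] /andP[_ kd].
case: k kd IH => [kd _|k kd IH].
  by exists K1 => // a n y; rewrite addn1.
have [K Ka KE] := IH (ltnW kd).
have ckd : (d - k.+2)%:R != 0 :> R[i] by rewrite pnatr_eq0 subn_eq0 -ltnNge.
exists (fun x => (- k.+1%:R / (d - k.+2)%:R) *:
   (\sum_j Sa j (K (S j x)) - (d.-1%:R / k.+1%:R) *: K1 x)).
  apply: adjointable_scale; apply: adjointable_add; first exact: adjW.
  exact/adjointable_opp/adjointable_scale.
move=> a n y; rewrite K1E.
under eq_bigr do rewrite (diag_shift Ka KE) linearZ/=.
rewrite -scaler_sumr sum_Sa_S_u !scalerA -scalerBl scalerA; congr (_ *: _).
have dE : d%:R = (d - k.+2)%:R + k%:R + 2 :> R[i].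
  by rewrite -addrA -natrD -natrD addn2 subnK// ltnW.
have d1E : d.-1%:R = (d - k.+2)%:R + k%:R + 1 :> R[i].
  apply: (addIr 1); rewrite natr1 prednK; last exact: ltn_trans kd.
  by rewrite dE; ring.
have := natn n; have := natn (n + k)%N; have := natn (n + k.+1)%N; have := natn k.
move: ckd; rewrite [(n + d)%:R]natrD dE d1E !addnS !addSn -!natr1 !natrD.
move: (d - k.+2)%:R (n%:R : R[i]) (k%:R : R[i]) => D N Q D0 h1 h2 h3 h4.
by field; rewrite h1 h2 h4 D0.
Qed.

(** The operator N / (N + m), as 1 - m (N + m)^-1.  For m = 0 the identity takes
    its place: the two differ only on constants, which the adjoints of the S_j kill. *)
Lemma degree_weight m : (m < d)%N -> exists D k, [/\ adjointable D,
  forall a n y, D (u a n y) = k n *: u a n y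
  & forall n, k n.+1 = n.+1%:R / (n.+1 + m)%:R].
Proof.
case: m => [_|m md].
  exists id, (fun=> 1); split => [|a n y|n]; [exact: adjointable_id|by rewrite scale1r|].
  by rewrite addn0 divff// pnatr_eq0.
have [K Ka KE] := @degree_inverse m.+1 md.
exists (fun x => x - m.+1%:R *: K x), (fun n => n%:R / (n + m.+1)%:R); split => //.
  apply: adjointable_add; first exact: adjointable_id.
  exact/adjointable_opp/adjointable_scale.
move=> a n y; rewrite KE scalerA -{1}[u a n y]scale1r -scalerBl; congr (_ *: _).
have : (n + m.+1)%:R != 0 :> R[i] by rewrite pnatr_eq0 addnS.
by rewrite natrD => h; field.
Qed.

(** The coefficients (adjoint of S_j) N (N + q)^-1 of the homotopy, with
    K = (N + q)^-1.  The first identity is the rule of Leibniz and the second one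
    is Euler's identity, each divided by N + q. *)
Lemma shift_homotopy q : (0 < q < d)%N ->
  exists (G G' : 'I_d -> {linear F -> F}) (K : F -> F),
    (forall i j x, G' j (S i x) = S i (G j x) + (i == j)%:R *: K x) /\
    (forall x, \sum_i S i (G i x) + q%:R *: K x = x).
Proof.
move=> /andP[q0 qd].
have [K Ka KE] : exists2 K, adjointable K &
  forall a n y, K (u a n y) = (n + q)%:R^-1 *: u a n y by apply: degree_inverse; rewrite q0.
have [D [k [Da DE kE]]] := degree_weight qd.
have [D' [k' [D'a D'E k'E]]] := @degree_weight q.-1 (leq_ltn_trans (leq_pred q) qd).
have SaD E : adjointable E -> exists G : 'I_d -> {linear F -> F},
    forall j, G j =1 Sa j \o E.
  move=> Ea; have /choice[G GE] j : exists h : {linear F -> F}, h =1 Sa j \o E.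
    exact/linear_exists/adjointable_linear/adjointable_comp/Ea/adj_Sa.
  by exists G.
have [[G GE] [G' G'E]] := (SaD _ Da, SaD _ D'a).
exists G, G', K.
have Gu j a n y : G j (u a n y) = ((n%:R / (n + q)%:R) * a j) *: u a n.-1 y.
  rewrite GE/= DE linearZ/=; case: n => [|n]; first by rewrite Sa_u0 scaler0 !mul0r scale0r.
  by rewrite kE Sa_uS scalerA.
have nq n : (n + q)%:R != 0 :> R[i] by rewrite pnatr_eq0 addn_eq0 negb_and -!lt0n q0 orbT.
have adjG j : adjointable (G j).
  by have := adjointable_comp (adj_Sa j) Da; rewrite -(funext (GE j)).
have adjG' j : adjointable (G' j).
  by have := adjointable_comp (adj_Sa j) D'a; rewrite -(funext (G'E j)).
split.
- move=> i j; apply: eq_on_u.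
  + exact: (adjointable_comp (adjG' j) (adj_S i)).
  + apply: adjointable_add; first exact: (adjointable_comp (adj_S i) (adjG j)).
    exact: adjointable_scale.
  move=> a n y; rewrite Gu KE G'E/= (diag_shift D'a D'E) linearZ/= k'E Sa_S_uE.
  rewrite !scalerA addSn -addnS prednK// mulrAC divff ?pnatr_eq0// mul1r.
  rewrite scalerDr addrC !scalerA linearZ/=; congr (_ *: _ + _ *: _); last by rewrite mulrC.
  by rewrite mulrCA mulrA.
- apply: eq_on_u.
  + apply: adjointable_add; last exact: adjointable_scale.
    apply: adjointable_sum => i; exact: (adjointable_comp (adj_S i) (adjG i)).
  + exact: adjointable_id.
  move=> a n y; under eq_bigr do rewrite Gu linearZ/= mulrAC [_ * _^-1]mulrC -scalerA.
  rewrite -scaler_sumr comb_u KE !scalerA -scalerDl -[RHS]scale1r; congr (_ *: _).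
  by have := nq n; rewrite natrD => h; field.
Qed.

(** In top degree the homotopy only has to invert the column (S_1, ..., S_d) on the
    left; this avoids (N + d)^-1, which the recursion of [degree_inverse] does
    not reach. *)
Lemma shift_homotopy_top : (0 < d)%N ->
  exists G : 'I_d -> {linear F -> F}, forall x, \sum_j G j (S j x) = x.
Proof.
move=> d0; have [D [k [Da DE kE]]] := @degree_weight d.-1 (eq_leq (prednK d0)).
have /choice[G GE] j : exists h : {linear F -> F}, h =1 Sa j \o D.
  exact/linear_exists/adjointable_linear/adjointable_comp/Da/adj_Sa.
exists G; apply: eq_on_u; [|exact: adjointable_id|].
  apply: adjointable_sum => j; rewrite (funext (GE j)).
  exact: (adjointable_comp (adjointable_comp (adj_Sa j) Da) (adj_S j)).
move=> a n y.
under eq_bigr do rewrite GE/= (diag_shift Da DE) linearZ/=.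
rewrite -scaler_sumr sum_Sa_S_u scalerA kE -[RHS]scale1r; congr (_ *: _).
rewrite addSn -addnS prednK// mulf_div [_ * (n + d)%:R]mulrC divff//.
by rewrite mulf_neq0 ?pnatr_eq0// addn_eq0 negb_and -!lt0n d0 orbT.
Qed.

End ShiftModel.

(** A change of basis E of C^d is not transported to the exterior powers, where it
    would act by minors.  Instead the homotopy for S is turned into one for the
    tuple E S, by applying the inverse transpose of E to its coefficients. *)
Section BaseChange.
From mathcomp Require Import finset.
Context {R : realType} {d : nat} {C F : hilbertType R}.
Context {S : 'I_d -> {linear F -> F}} {e : Cn R d -> C -> F} {ev0 : F -> C}.
Hypothesis model : shift_model S e ev0.
Variables (E : 'M[R[i]]_d) (S' : 'I_d -> {linear F -> F}).
Hypotheses (Eunit : E \in unitmx) (S'E : forall i x, S' i x = \sum_m E i m *: S m x).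

Let E' := invmx E.
Let EE' i j : \sum_m E i m * E' m j = (i == j)%:R.
Proof. by have /matrixP/(_ i j) := mulmxV Eunit; rewrite !mxE. Qed.
Let E'E i j : \sum_m E' i m * E m j = (i == j)%:R.
Proof. by have /matrixP/(_ i j) := mulVmx Eunit; rewrite !mxE. Qed.

Let base_change (G : 'I_d -> {linear F -> F}) :
  exists G1 : 'I_d -> {linear F -> F}, forall i x, G1 i x = \sum_j E' j i *: G j x.
Proof.
have /choice[G1 G1E] i : exists h : {linear F -> F}, h =1 (fun x => \sum_j E' j i *: G j x).
  apply: linear_exists => a x y; rewrite scaler_sumr -big_split; apply: eq_bigr => j _ /=.
  by rewrite linearP scalerDr !scalerA mulrC.
by exists G1.
Qed.

Let sum_inv (A : 'I_d -> 'I_d -> F) :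
  \sum_i \sum_l \sum_j (E i l * E' j i) *: A l j = \sum_j A j j.
Proof.
rewrite exchange_big/=; apply: eq_bigr => l _; rewrite exchange_big/= (bigD1 l)//=.
have EE2 j : \sum_i E i l * E' j i = (j == l)%:R.
  by rewrite -E'E; apply: eq_bigr => i _; rewrite mulrC.
rewrite -scaler_suml EE2 eqxx scale1r big1 ?addr0// => j jl.
by rewrite -scaler_suml EE2 (negPf jl) scale0r.
Qed.

Lemma shift_koszul_exact k (x : {ffun ksubset d k.+1 -> F}) :
  koszul_tuple S' x = 0 -> exists y : {ffun ksubset d k.+2 -> F}, koszul_tuple S' y = x.
Proof.
have [kd|kd|kd] := ltngtP k.+1 d.
- have [G [G' [K [GS hom]]]] := @shift_homotopy _ _ _ _ _ _ _ model k.+1 kd.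
  have [G1 G1E] := base_change G; have [G1' G1'E] := base_change G'.
  have GS' i j y : G1' j (S' i y) = S' i (G1 j y) + (i == j)%:R *: K y.
    rewrite G1'E !S'E G1E -EE' scaler_suml -big_split/=.
    under eq_bigr do rewrite linear_sum scaler_sumr.
    rewrite exchange_big/=; apply: eq_bigr => m _.
    under eq_bigr do rewrite !linearZ/= GS scalerDr scalerDr scalerA.
    rewrite big_split/= linear_sum scaler_sumr/=; congr (_ + _).
      by apply: eq_bigr => l _; rewrite linearZ/= !scalerA mulrC.
    rewrite (bigD1 m)//= eqxx scale1r !scalerA mulrC big1 ?addr0// => l.
    by rewrite eq_sym => /negPf->; rewrite scale0r !scaler0.
  have hom' y : \sum_i S' i (G1 i y) + k.+1%:R *: K y = y.
    rewrite -[RHS]hom; congr (_ + _); rewrite -(sum_inv (fun l j => S l (G j y))).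
    apply: eq_bigr => i _; rewrite S'E G1E; apply: eq_bigr => l _.
    by rewrite linear_sum scaler_sumr; apply: eq_bigr => j _; rewrite linearZ/= scalerA.
  apply: (koszul_tuple_exact (G := G1) (G' := G1')).
    by move=> _ i j y /negPf ij; rewrite GS' ij scale0r addr0.
  move=> T y Tk; under [X in _ + X]eq_bigr do rewrite GS' eqxx scale1r.
  rewrite [X in _ + X]big_split/= addrA addrC sumr_const Tk.
  rewrite -[RHS]hom' (bigID (mem T) xpredT)/= scaler_nat addrC; congr (_ + _).
  by rewrite addrC.
- apply: (koszul_tuple_exact (G := S') (G' := S')); first by rewrite ltnNge (ltnW kd).
  move=> T y Tk; have := max_card (mem T); rewrite card_ord Tk.
  by rewrite leqNgt kd.
- have d0 : (0 < d)%N by rewrite -kd.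
  have [G hom] := @shift_homotopy_top _ _ _ _ _ _ _ model d0.
  have [G1 G1E] := base_change G.
  apply: (koszul_tuple_exact (G := S') (G' := G1)); first by rewrite kd ltnn.
  move=> T y Tk; have -> : T = [set: 'I_d].
    by apply/eqP; rewrite eqEcard finset.subsetT cardsT card_ord Tk kd leqnn.
  rewrite big_pred0 ?add0r => [|i]; last by rewrite inE.
  under eq_bigl do rewrite inE.
  rewrite -[RHS]hom -(sum_inv (fun l j => G j (S l y))); apply: eq_bigr => i _.
  rewrite [RHS]exchange_big/= G1E S'E; apply: eq_bigr => j _.
  rewrite linear_sum scaler_sumr/=; apply: eq_bigr => l _.
  by rewrite linearZ/= scalerA mulrC.
Qed.

End BaseChange.

(** * Automorphisms of the ball *)

Section BallAutomorphism.
Context {R : realType} {d : nat}.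
Implicit Types (l v w z : Cn R d).

Lemma CdotC z w : Cdot w z = (Cdot z w)^*.
Proof.
rewrite /Cdot rmorph_sum/=; apply: eq_bigr => i _.
by rewrite rmorphM/= conjCK mulrC.
Qed.

Lemma CsqnormE z : Csqnorm z = Cdot z z.
Proof. by apply: eq_bigr => i _; rewrite normCK. Qed.

Lemma CdotDl z w v : Cdot (z + w) v = Cdot z v + Cdot w v.
Proof. by rewrite /Cdot -big_split; apply: eq_bigr => i _; rewrite /= mxE mulrDl. Qed.

Lemma CdotZl a z w : Cdot (a *: z) w = a * Cdot z w.
Proof. by rewrite /Cdot mulr_sumr; apply: eq_bigr => i _; rewrite mxE mulrA. Qed.

Lemma CdotDr z w v : Cdot v (z + w) = Cdot v z + Cdot v w.
Proof. by rewrite CdotC CdotDl rmorphD/= -!CdotC. Qed.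

Lemma CdotZr a z w : Cdot z (a *: w) = a^* * Cdot z w.
Proof. by rewrite CdotC CdotZl rmorphM/= -CdotC. Qed.

Lemma CdotNr z w : Cdot z (- w) = - Cdot z w.
Proof. by rewrite -scaleN1r CdotZr rmorphN1 mulN1r. Qed.

Lemma Cdot0r z : Cdot z 0 = 0.
Proof. by rewrite -(scale0r 0) CdotZr conjC0 mul0r. Qed.

Lemma CdotNl z w : Cdot (- z) w = - Cdot z w.
Proof. by rewrite -scaleN1r CdotZl mulN1r. Qed.

Definition mob_rad l : R[i] := sqrtC (1 - Csqnorm l).

(** The automorphism of the ball with mob l 0 = l and inverse mob (- l); the
    usual formula divides by |l|^2, which here has been cancelled against
    1 - s^2 = |l|^2, so that l = 0 is not a special case. *)
Definition mob l w : Cn R d := (1 + Cdot w l)^-1 *: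
  (mob_rad l *: w + (1 + Cdot w l / (1 + mob_rad l)) *: l).

Section Mob.
Variable l : Cn R d.
Hypothesis lB : oball R d l.
Local Notation s := (mob_rad l).

Lemma mob_rad_gt0 : 0 < s.
Proof. by rewrite sqrtC_gt0 subr_gt0. Qed.

Lemma mob_rad_sqr : Cdot l l = 1 - s ^+ 2.
Proof. by rewrite sqrtCK CsqnormE opprB addrC subrK. Qed.

Lemma mob_rad1 : 1 + s != 0.
Proof. by rewrite gt_eqF// addr_gt0// mob_rad_gt0. Qed.

Lemma mob_rad_conj : s^* = s.
Proof. by rewrite conj_Creal// gtr0_real// mob_rad_gt0. Qed.

Lemma oballN v : oball R d v -> oball R d (- v).
Proof. by rewrite /oball/= !CsqnormE CdotNl CdotNr opprK. Qed.

Lemma mob_denom w : oball R d w -> 1 + Cdot w l != 0.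
Proof. by move=> wB; have := Cdot_neq1 (oballN lB) wB; rewrite CdotNr opprK. Qed.

Lemma mob_denom_conj w : oball R d w -> 1 + Cdot l w != 0.
Proof.
by move=> wB; rewrite CdotC -(rmorph1 (@Num.conj R[i])) -rmorphD fmorph_eq0 mob_denom.
Qed.

(** The invariance of the kernel 1 / (1 - <w, v>) up to a factor
    g(w) conj(g(v)). *)
Lemma one_sub_mob v w : oball R d v -> oball R d w ->
  1 - Cdot (mob l w) (mob l v) =
  s ^+ 2 * (1 - Cdot w v) / ((1 + Cdot w l) * (1 + Cdot l v)).
Proof.
move=> vB wB; rewrite /mob CdotZl CdotZr !(CdotDl, CdotDr, CdotZl, CdotZr).
rewrite !(rmorphD, rmorphM, fmorphV, rmorph1) /= -!CdotC mob_rad_conj mob_rad_sqr.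
have := mob_denom wB; have := mob_denom_conj vB; have := mob_rad1.
move: (Cdot w l) (Cdot l v) (Cdot w v) => a b c h1 h2 h3.
by field; rewrite h1 h2 h3.
Qed.

Lemma mob_ball v : oball R d v -> oball R d (mob l v).
Proof.
move=> vB; rewrite /oball/= CsqnormE -subr_gt0 one_sub_mob//.
rewrite divr_gt0//; first by rewrite mulr_gt0 ?exprn_gt0 ?mob_rad_gt0// -CsqnormE subr_gt0.
have -> : (1 + Cdot v l) * (1 + Cdot l v) = `|1 + Cdot v l| ^+ 2.
  by rewrite normCK rmorphD/= rmorph1 -CdotC.
by rewrite exprn_gt0// normr_gt0 mob_denom.
Qed.

Lemma one_sub_mob_center v : oball R d v -> 1 - Cdot (mob l v) l = s ^+ 2 / (1 + Cdot v l).
Proof.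
move=> vB; rewrite /mob CdotZl CdotDl !CdotZl mob_rad_sqr.
have := mob_denom vB; have := mob_rad1.
by move: (Cdot v l) => a h1 h2; field; rewrite h1 h2.
Qed.

End Mob.

Lemma mob_radN l : mob_rad (- l) = mob_rad l.
Proof. by rewrite /mob_rad !CsqnormE CdotNl CdotNr opprK. Qed.

Lemma mobK l z : oball R d l -> oball R d z -> mob l (mob (- l) z) = z.
Proof.
move=> lB zB; have lB' := oballN lB.
have t1 : 1 + Cdot (mob (- l) z) l = mob_rad l ^+ 2 / (1 - Cdot z l).
  have := one_sub_mob_center lB' zB.
  by rewrite !CdotNr opprK mob_radN.
rewrite {1}/mob t1.
have t0 : Cdot (mob (- l) z) l = mob_rad l ^+ 2 / (1 - Cdot z l) - 1 by rewrite -t1 addrC addKr.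
rewrite t0 /mob mob_radN CdotNr scalerN !scalerDr !scalerN !scalerA.
rewrite -addrA -scaleNr -scalerDl.
have := mob_rad_gt0 lB; have := mob_rad1 lB; have := mob_denom lB' zB; rewrite CdotNr.
move: (Cdot z l) (mob_rad l) => t s h1 h2 /gt_eqF/negbT h3.
rewrite -[RHS]scale1r -[RHS]addr0 -(scale0r l).
by congr (_ *: _ + _ *: _); field; rewrite ?h1 ?h2 ?h3.
Qed.

Lemma mob0 l : oball R d l -> mob l 0 = l.
Proof.
move=> lB; rewrite /mob; have -> : Cdot 0 l = 0 by rewrite CdotC Cdot0r conjC0.
by rewrite mul0r addr0 invr1 scaler0 add0r !scale1r.
Qed.

End BallAutomorphism.

(** * Free modules *)

Section AdModule.
Context {R : realType} {d : nat} {H : hilbertType R}.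
Variable M : Ad_module d H.

Lemma act1 x : M 1 x = x.
Proof. by have := actC M 1 x; rewrite scale1r. Qed.

Lemma act0 x : M 0 x = 0.
Proof. by have := actC M 0 x; rewrite scale0r /cpoly mpolyC0. Qed.

Lemma act_sum I (r : seq I) (p : I -> Apoly R d) x :
  M (\sum_(i <- r) p i) x = \sum_(i <- r) M (p i) x.
Proof.
elim: r => [|i r IH]; first by rewrite !big_nil act0.
by rewrite !big_cons actD IH.
Qed.

Lemma act_opp p x : M (- p) x = - M p x.
Proof.
by apply: (addrI (M p x)); rewrite -actD !subrr act0.
Qed.

Lemma actCom p q x : M p (M q x) = M q (M p x).
Proof. by rewrite -!actM mulrC. Qed.

Lemma act_denom (l : Cn R d) x :
  M (mobius_denom l) x = x - \sum_i (l 0 i)^* *: M (zvar R i) x.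
Proof.
rewrite /mobius_denom actD act1 act_opp act_sum; congr (_ - _).
by apply: eq_bigr => i _; rewrite actM actC.
Qed.

Hypothesis Mc : contractive M.

Lemma contractive_comb_bound (a : 'I_d -> R[i]) x :
  `|\sum_i a i *: M (zvar R i) x| <= sqrtC (\sum_i `|a i| ^+ 2) * `|x|.
Proof.
have A0 : 0 <= \sum_i `|a i| ^+ 2 by rewrite sumr_ge0// => *; rewrite exprn_ge0.
rewrite -(@ler_pXn2r _ 2) ?nnegrE ?mulr_ge0 ?sqrtC_ge0// exprMn sqrtCK.
have := Mc (fun i => a i *: x).
under eq_bigr do rewrite linearZ/=.
move=> /le_trans; apply; rewrite mulr_suml ler_sum// => i _.
by rewrite normrZ exprMn.
Qed.

Lemma contractive_var_bound i x : `|M (zvar R i) x| <= `|x|.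
Proof.
have := contractive_comb_bound (fun j => (j == i)%:R) x.
rewrite (bigD1 i)//= eqxx scale1r big1 ?addr0; last by move=> j /negPf->; rewrite scale0r.
rewrite (bigD1 i)//= eqxx normr1 expr1n big1 ?addr0 ?sqrtC1 ?mul1r//.
by move=> j /negPf->; rewrite normr0 expr0n.
Qed.

Lemma denom_inverse (l : Cn R d) : oball R d l -> exists Z : {linear H -> H},
  [/\ cancel (M (mobius_denom l)) Z, cancel Z (M (mobius_denom l))
    & exists2 c, 0 <= c & forall x, `|Z x| <= c * `|x|].
Proof.
move=> lB; pose q := sqrtC (Csqnorm l).
have N0 : 0 <= Csqnorm l by rewrite sumr_ge0// => *; rewrite exprn_ge0.
have q0 : 0 <= q by rewrite sqrtC_ge0.
have q1 : q < 1 by rewrite -sqrtC1 ltr_sqrtC ?qualifE/=.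
have [X XE] : exists X : {linear H -> H}, X =1 (fun x => \sum_i (l 0 i)^* *: M (zvar R i) x).
  apply: linear_exists => a x y; rewrite scaler_sumr -big_split; apply: eq_bigr => i _ /=.
  by rewrite linearP scalerDr !scalerA mulrC.
have Xq x : `|X x| <= q * `|x|.
  rewrite XE (le_trans (contractive_comb_bound _ _))//.
  by under eq_bigr do rewrite norm_conjC.
have [Z [ZK KZ]] := sub_contraction_bij q0 q1 Xq.
exists Z; split.
- by move=> x; rewrite act_denom -XE ZK.
- by move=> x; rewrite act_denom -XE KZ.
- have q10 : 0 < 1 - q by rewrite subr_gt0.
  exists (1 - q)^-1; first by rewrite invr_ge0 ltW.
  move=> x; rewrite mulrC ler_pdivlMr// mulrBr mulr1 lerBlDr.
  rewrite -[in leLHS](subrK (X (Z x)) (Z x)) KZ (le_trans (ler_normD _ _))// lerD2l.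
  by rewrite mulrC Xq.
Qed.

End AdModule.

Section FreeModule.
Context {R : realType} {d : nat} {H2 : hilbertType R} {D : drury_arveson d H2}.
Context {C F : hilbertType R} (L : free_module D C F).
Implicit Types (z w : Cn R d) (x : F).

Local Notation T i := (L (zvar R i)).

(** A total function of z; its values outside of the ball are arbitrary. *)
Definition ball_pt z : oball R d := insubd (oball0 : oball R d) z.
Definition fkernel z (y : C) : F := free_tensor L (da_kernel D (ball_pt z)) y.

Lemma ball_ptK z : oball R d z -> val (ball_pt z) = z.
Proof. by move=> zB; rewrite insubdK// inE. Qed.

Lemma fkernel_val (l : oball R d) y : fkernel (val l) y = free_tensor L (da_kernel D l) y.
Proof. by rewrite /fkernel /ball_pt valKd. Qed.

Lemma oball_val (l : oball R d) : oball R d (val l).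
Proof. by have := valP l; rewrite inE. Qed.

Lemma fkernel_tensor z y f y' : oball R d z ->
  hdot (free_tensor L f y') (fkernel z y) = da_eval D f z * hdot y' y.
Proof. by move=> zB; rewrite tensor_dot da_reproducing ball_ptK. Qed.

Lemma fkernel_gram v w y y' : oball R d v -> oball R d w ->
  hdot (fkernel v y) (fkernel w y') = hdot y y' / (1 - Cdot w v).
Proof.
by move=> vB wB; rewrite fkernel_tensor// da_kernelE// ball_ptK// mulrC.
Qed.

Lemma tensor_approx x (e : R[i]) : 0 < e ->
  exists n (f : 'I_n -> H2) (y : 'I_n -> C),
    `|x - \sum_(i < n) free_tensor L (f i) (y i)| < e.
Proof.
move=> e0; have [||t [xt [n [f [y tE]]]]] := tensor_dense (free_tensor L) (O := ball x e).
- by exists x; apply: ballxx.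
- exact: ball_open.
- by exists n, f, y; move: xt; rewrite -ball_normE/= tE.
Qed.

Lemma tensor_total x : (forall f y, hdot x (free_tensor L f y) = 0) -> x = 0.
Proof.
move=> xT; apply: normr0_eq0; apply: (@eq0_of_small _ _ 1 1) => // e e0 _.
rewrite normr_id mulr1; have [n [f [y xt]]] := tensor_approx x e0.
set t := (\sum_(i < n) _) in xt.
have [->|xn0] := eqVneq x 0; first by rewrite normr0 ltW.
have x0 : 0 < `|x| by rewrite normr_gt0.
have xE : hdot x (x - t) = `|x| ^+ 2.
  by rewrite hdotBr hdot_norm hdot_sumr big1 ?subr0.
have := CS_hdot x (x - t); rewrite xE ger0_norm ?exprn_ge0// expr2 ler_pM2l//.
by move=> /le_trans; apply; apply: ltW.
Qed.

(** Known on elementary tensors, and both sides are continuous in x. *)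
Lemma free_var_eval i x z y : oball R d z ->
  hdot (T i x) (fkernel z y) = z 0 i * hdot x (fkernel z y).
Proof.
move=> zB; apply/subr0_eq.
pose B := (1 + `|z 0 i|) * `|fkernel z y|.
apply: (@eq0_of_small _ _ B 1) => //; first by rewrite mulr_ge0// addr_ge0.
move=> e e0 _; have [n [f [y' xt]]] := tensor_approx x e0.
set t := (\sum_(i < n) _) in xt.
have tE : hdot (T i t) (fkernel z y) - z 0 i * hdot t (fkernel z y) = 0.
  rewrite linear_sum !hdot_suml mulr_sumr -sumrB big1// => j _.
  rewrite (free_actE L) !fkernel_tensor// da_moduleE//.
  by rewrite /peval /zvar mevalXU mulrA subrr.
have -> : hdot (T i x) (fkernel z y) - z 0 i * hdot x (fkernel z y) =
    hdot (T i (x - t)) (fkernel z y) - z 0 i * hdot (x - t) (fkernel z y).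
  by rewrite [L _ (_ - _)]linearB !hdotBl (subr0_eq tE); ring.
rewrite (le_trans (ler_normB _ _))// /B mulrDl mul1r mulrDr lerD//.
  rewrite (le_trans (CS_hdot _ _))// ler_wpM2r//.
  by rewrite (le_trans (contractive_var_bound (free_contractive L) _ _))// ltW.
rewrite normrM mulrCA ler_wpM2l// (le_trans (CS_hdot _ _))// ler_wpM2r//.
exact: ltW.
Qed.

(** For fixed y, the functional f |-> <f (x) y, x> is represented by an element g
    of H_d^2, whose value at z is conjugate to <k_z (x) y, x>; thus g = 0, and x
    is orthogonal to all elementary tensors. *)
Lemma fkernel_total x :
  (forall z y, oball R d z -> hdot x (fkernel z y) = 0) -> x = 0.
Proof.
move=> xk; apply: tensor_total => f y; rewrite hdotC.
have [phi phiE] : exists phi : {linear H2 -> R[i]^o},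
    phi =1 (fun f => hdot (free_tensor L f y) x).
  by apply: linear_exists => a g h; rewrite linearPl/= hdotPl.
have [|g|g gE] := @riesz _ _ phi (`|y| * `|x|); first exact: mulr_ge0.
  rewrite phiE (le_trans (CS_hdot _ _))// [leRHS]mulrAC ler_wpM2r// mulrC.
  rewrite -(@ler_pXn2r _ 2) ?nnegrE ?mulr_ge0// exprMn -!hdot_norm tensor_dot.
  by rewrite !hdot_norm.
rewrite -phiE gE.
have -> : g = 0.
  apply: (@da_eval_inj _ _ _ D) => z zB.
  rewrite -(ball_ptK zB) -!da_reproducing hdotC -gE phiE hdotC conjCK.
  by rewrite -/(fkernel z y) xk// hdot0l.
by rewrite hdot0r conjC0.
Qed.

Lemma free_evalP x (l : oball R d) y :
  hdot (free_eval L x l) y = hdot x (fkernel (val l) y).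
Proof. by rewrite fkernel_val free_evalE. Qed.

End FreeModule.

Section MobiusMatrix.
Context {R : realType} {d : nat}.
Variable l : Cn R d.
Hypothesis lB : oball R d l.
Local Notation s := (mob_rad l).

(** The matrix B of the linear part of the automorphism: mob (- l) z is
    B (z - l) / (1 - <z, l>). *)
Definition mob_mx : 'M[R[i]]_d :=
  \matrix_(i, j) (s * (i == j)%:R + l 0 i * (l 0 j)^* / (1 + s)).

Lemma mob_mx_row i (a : 'I_d -> R[i]) :
  \sum_j mob_mx i j * a j = s * a i + l 0 i / (1 + s) * \sum_j (l 0 j)^* * a j.
Proof.
under eq_bigr do rewrite mxE mulrDl.
rewrite big_split/=; congr (_ + _).
  rewrite (bigD1 i)//= eqxx mulr1 big1 ?addr0// => j.
  by rewrite eq_sym => /negPf->; rewrite mulr0 mul0r.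
by rewrite mulr_sumr; apply: eq_bigr => j _; ring.
Qed.

Lemma mob_mx_unit : mob_mx \in unitmx.
Proof.
have s0 := mob_rad_gt0 lB; have s1 := mob_rad1 lB.
have sn0 : s != 0 by rewrite gt_eqF.
pose B' : 'M[R[i]]_d := \matrix_(i, j) (s^-1 * ((i == j)%:R - l 0 i * (l 0 j)^* / (1 + s))).
suff : mob_mx *m B' = 1%:M by case/mulmx1_unit.
apply/matrixP => i k; rewrite !mxE mob_mx_row mxE.
have -> : \sum_j (l 0 j)^* * B' j k = (l 0 k)^*.
  transitivity (s^-1 * (\sum_j (l 0 j)^* * (j == k)%:R - Cdot l l * ((l 0 k)^* / (1 + s)))).
    rewrite /Cdot mulr_suml -sumrB mulr_sumr; apply: eq_bigr => j _.
    by rewrite mxE; ring.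
  rewrite (bigD1 k)//= eqxx mulr1 big1 ?addr0 => [|j /negPf->]; last by rewrite mulr0.
  by rewrite mob_rad_sqr//; field; rewrite ?s1 ?sn0.
by field; rewrite ?s1 ?sn0.
Qed.

Lemma mob_mx_affine i z : oball R d z ->
  \sum_j mob_mx i j * (z 0 j - l 0 j) = mob (- l) z 0 i * (1 - Cdot z l).
Proof.
move=> zB; rewrite mob_mx_row.
have -> : \sum_j (l 0 j)^* * (z 0 j - l 0 j) = Cdot z l - Cdot l l.
  by rewrite /Cdot -sumrB; apply: eq_bigr => j _; ring.
rewrite mob_rad_sqr// /mob !mxE mob_radN CdotNr.
have := mob_denom (oballN lB) zB; rewrite CdotNr => h1; have h2 := mob_rad1 lB.
by move: h1; move: (Cdot z l) => t h1; field; rewrite ?h1 ?h2.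
Qed.

End MobiusMatrix.

(** Here Z is the inverse of 1 - <T, l>, and the operators S_i of
    [mobius_shift_model] are the coordinates of mob (- l) applied to T. *)
Section MobiusModel.
Context {R : realType} {d : nat} {H2 : hilbertType R} {D : drury_arveson d H2}.
Context {C F : hilbertType R} (L : free_module D C F) (l : oball R d).
Local Notation c := (val l : Cn R d).
Local Notation s := (mob_rad c).
Local Notation T i := (L (zvar R i)).
Let cB : oball R d c. Proof. exact: oball_val. Qed.

Context {Z : {linear F -> F}}.
Hypotheses (ZK : cancel Z (L (mobius_denom c)))
  (Zbound : exists2 b, 0 <= b & forall x, `|Z x| <= b * `|x|).

Lemma inverse_eval x z y : oball R d z ->
  hdot x (fkernel L z y) = (1 - Cdot z c) * hdot (Z x) (fkernel L z y).
Proof.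
move=> zB; rewrite -{1}[x]ZK act_denom hdotBl hdot_suml mulrBl mul1r; congr (_ - _).
rewrite /Cdot mulr_suml; apply: eq_bigr => i _.
by rewrite hdotZl free_var_eval// mulrA [_^* * _]mulrC.
Qed.

Definition mob_kernel (v : Cn R d) (y : C) : F :=
  (s / (1 + Cdot c v)) *: fkernel L (mob c v) y.

(** Composition with an automorphism permutes the kernel functions up to scalars,
    and [one_sub_mob] says that the scalars in [mob_kernel] restore the Gram
    matrix.  The origin of the new model is l. *)
Lemma mobius_shift_model (S : 'I_d -> {linear F -> F}) :
  (forall i x, S i x = \sum_j mob_mx c i j *: (T j (Z x) - c 0 j *: Z x)) ->
  shift_model S mob_kernel (fun x => s *: free_eval L x l).
Proof.
move=> SE.
have s0 := mob_rad_gt0 cB; have sn0 : s != 0 by rewrite gt_eqF.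
have Seval i x z y : oball R d z ->
    hdot (S i x) (fkernel L z y) = mob (- c) z 0 i * hdot x (fkernel L z y).
  move=> zB; rewrite SE hdot_suml (inverse_eval x)// mulrA -mob_mx_affine// mulr_suml.
  apply: eq_bigr => j _; rewrite hdotZl hdotBl hdotZl free_var_eval//; ring.
split.
- have [b b0 Zb] := Zbound.
  exists (\sum_i \sum_j `|mob_mx c i j| * (b + `|c 0 j| * b)).
    by rewrite sumr_ge0// => i _; rewrite sumr_ge0// => j _; rewrite mulr_ge0 ?addr_ge0 ?mulr_ge0.
  move=> i x; rewrite SE (le_trans (ler_norm_sum _ _ _))//.
  rewrite [in leRHS](bigD1 i)//= mulrDl mulr_suml -[leLHS]addr0 lerD//.
    apply: ler_sum => j _; rewrite normrZ -mulrA ler_wpM2l//.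
    rewrite (le_trans (ler_normB _ _))// mulrDl lerD//.
      by rewrite (le_trans (contractive_var_bound (free_contractive L) _ _)).
    by rewrite normrZ -mulrA ler_wpM2l.
  rewrite mulr_ge0// sumr_ge0// => k _; rewrite sumr_ge0// => j _.
  by rewrite mulr_ge0 ?addr_ge0 ?mulr_ge0.
- move=> i x v y vB; rewrite /mob_kernel !hdotZr Seval; last exact: mob_ball.
  have -> : mob (- c) (mob c v) = v by have := mobK (oballN cB) vB; rewrite opprK.
  ring.
- move=> v w y z vB wB; rewrite /mob_kernel hdotZl hdotZr fkernel_gram; last 2 first.
  - exact: mob_ball.
  - exact: mob_ball.
  rewrite one_sub_mob// rmorphM fmorphV rmorphD rmorph1/= mob_rad_conj// -CdotC.
  have := mob_denom cB wB; have := mob_denom_conj cB vB; have := Cdot_neq1 vB wB.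
  move: (Cdot w c) (Cdot c v) (Cdot w v) => a b g h1 h2 h3.
  by field; rewrite ?sn0 ?h1 ?h2 ?h3.
- move=> x xk; apply: (@fkernel_total _ _ _ _ _ _ L) => z y zB.
  have wB := mob_ball (oballN cB) zB.
  have := xk (mob (- c) z) y wB; rewrite /mob_kernel mobK// hdotZr => /eqP.
  rewrite mulf_eq0 conjC_eq0 mulf_eq0 invr_eq0 (negPf sn0) (negPf (mob_denom_conj cB wB)).
  by move/eqP.
- move=> x y; rewrite /mob_kernel Cdot0r addr0 divr1 mob0// hdotZl free_evalP hdotZr.
  by rewrite mob_rad_conj.
Qed.

End MobiusModel.

(** * The double complex *)

(** The column p of X p q is the position in the augmented resolution and the row
    q is the exterior degree; v and h are the vertical and horizontal maps.
    Only the columns p+1 are exact, once augmented by eps. *)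
Section DoubleComplex.
Context {K : pzRingType} (X : nat -> nat -> lmodType K) (C : nat -> lmodType K).
Variables (v : forall p q, {linear X p q.+1 -> X p q}).
Variables (h : forall p q, {linear X p.+1 q -> X p q}).
Variables (eps : forall p, {linear X p.+1 0%N -> C p}).
Variables (loc : forall p, {linear C p.+1 -> C p}).
Hypotheses
  (vh : forall p q x, v p q (h p q.+1 x) = h p q (v p.+1 q x))
  (vv : forall p q x, v p.+1 q (v p.+1 q.+1 x) = 0)
  (v_exact : forall p q x, v p.+1 q x = 0 -> exists y, v p.+1 q.+1 y = x)
  (hh : forall p q x, h p q (h p.+1 q x) = 0)
  (h_exact : forall p q x, h p q x = 0 -> exists y, h p.+1 q y = x)
  (h_surj : forall q x, exists y, h 0%N q y = x)
  (eps_v : forall p x, eps p (v p.+1 0%N x) = 0)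
  (eps_exact : forall p x, eps p x = 0 -> exists y, v p.+1 0%N y = x)
  (eps_surj : forall p x, exists y, eps p y = x)
  (eps_h : forall p x, eps p (h p.+1 0%N x) = loc p (eps p.+1 x)).

(* The subquotient ker (h v) / (ker h + ker v) at X p.+1 q.+1, which is the same
   for all positions on a diagonal. *)
Let Zdiag p q (a : X p.+1 q.+1) := h p q (v p.+1 q a) = 0.
Let Bdiag p q (a : X p.+1 q.+1) :=
  exists a1 a2, [/\ a = a1 + a2, h p q.+1 a1 = 0 & v p.+1 q a2 = 0].

Let Zdiag_linear p q k a b : @Zdiag p q a -> Zdiag b -> Zdiag (k *: a + b).
Proof. by rewrite /Zdiag !linearP => -> ->; rewrite scaler0 addr0. Qed.

Let diag_start q :
  subquot_iso (fun x => v 0%N q x = 0) (fun x => exists y, v 0%N q.+1 y = x)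
    (@Zdiag 0 q) (@Bdiag 0 q).
Proof.
apply: subquot_iso_sym.
apply: subquot_iso_eq (subquot_iso_sym
  (@subquot_iso_surj K _ _ _ _ _ (v 1 q.+1) (v 0 q.+1) (h 0 q.+2) (h 0 q.+1) (v 0 q) _ _ _)).
- by move=> x; rewrite vh.
- move=> x; split=> -[a1 [a2 [-> ha1 a2E]]]; exists a1, a2; split => //.
    by have [a' <-] := a2E; rewrite vv.
  exact: v_exact.
- by move=> a; rewrite vh.
- exact: h_surj.
- exact: h_surj.
Qed.

Let diag_step p q : subquot_iso (@Zdiag p q.+1) (@Bdiag p q.+1) (@Zdiag p.+1 q) (@Bdiag p.+1 q).
Proof.
have sq := @subquot_iso_square K _ _ _ _ (h p.+1 q.+2) (v p.+2 q.+1) (v p.+1 q.+1)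
  (h p.+1 q.+1) (@vh _ _).
apply: subquot_iso_eq (subquot_iso_sym (subquot_iso_eq _ _ (subquot_iso_sym sq))).
- move=> a; split => [[b ab]|/h_exact[b ab]]; last by exists b.
  by rewrite /Zdiag ab hh.
- move=> a; split=> -[a1 [a2 [-> a1E va2]]]; exists a1, a2; split => //.
    by have [a' <-] := a1E; rewrite hh.
  exact: h_exact.
- move=> b; rewrite /Zdiag -vh; split => [[a ab]|/v_exact[a ab]]; last by exists a.
  by rewrite ab vv.
- move=> b; split=> -[b1 [b2 [-> b1E vb2]]]; exists b1, b2; split => //.
    by have [b' <-] := vb2; rewrite vv.
  exact: v_exact.
Qed.

Let diag_end p : subquot_iso (@Zdiag p 0) (@Bdiag p 0)
  (fun x => loc p x = 0) (fun x => exists y, loc p.+1 y = x).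
Proof.
have sq := @subquot_iso_square K _ _ _ _ (h p.+1 1) (v p.+2 0) (v p.+1 0)
  (h p.+1 0) (@vh _ _).
pose Z (b : X p.+2 0) := loc p (eps p.+1 b) = 0.
pose B (b : X p.+2 0) := exists b1 b2, [/\ b = b1 + b2, h p.+1 0%N b1 = 0 & eps p.+1 b2 = 0].
apply: (@subquot_iso_trans K _ _ _ _ _ Z B); last first.
- by move=> k a b; rewrite /Z !linearP => -> ->; rewrite scaler0 addr0.
- apply: subquot_iso_eq (subquot_iso_sym
    (@subquot_iso_surj K _ _ _ _ _ (h p.+2 0) (loc p.+1) (eps p.+2) (eps p.+1) (loc p) _ _ _)).
  + by [].
  + move=> b; split=> -[b1 [b2 [-> b1E b2E]]]; exists b2, b1; rewrite addrC; split => //.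
      by have [b' <-] := b2E; rewrite hh.
    exact: h_exact.
  + exact: eps_h.
  + exact: eps_surj.
  + exact: eps_surj.
- apply: subquot_iso_eq (subquot_iso_sym (subquot_iso_eq _ _ (subquot_iso_sym sq))).
  + move=> a; split => [[b ab]|/h_exact[b ab]]; last by exists b.
    by rewrite /Zdiag ab hh.
  + move=> a; split=> -[a1 [a2 [-> a1E va2]]]; exists a1, a2; split => //.
      by have [a' <-] := a1E; rewrite hh.
    exact: h_exact.
  + move=> b; rewrite /Z -eps_h; split => [[a ab]|/eps_exact[a ab]]; last by exists a.
    by rewrite ab eps_v.
  + move=> b; split=> -[b1 [b2 [-> b1E vb2]]]; exists b1, b2; split => //.
      by have [b' <-] := vb2; rewrite eps_v.
    exact: eps_exact.
Qed.

Let diag_iso q p n : (p + q)%N = n -> subquot_iso (@Zdiag p q) (@Bdiag p q)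
  (fun x => loc n x = 0) (fun x => exists y, loc n.+1 y = x).
Proof.
elim: q p => [|q IH] p; first by rewrite addn0 => <-; exact: diag_end.
rewrite addnS -addSn => /IH iso; apply: subquot_iso_trans (diag_step p q) iso _.
exact: Zdiag_linear.
Qed.

(** The homology of column 0 in degree q is the subquotient at X 1 q.+1, which
    moves along the diagonal down to X q.+1 1 and then to the complex of
    the C p. *)
Theorem double_complex_iso q :
  subquot_iso (fun x => v 0%N q x = 0) (fun x => exists y, v 0%N q.+1 y = x)
    (fun x => loc q x = 0) (fun x => exists y, loc q.+1 y = x).
Proof.
apply: subquot_iso_trans (diag_start q) (diag_iso (add0n q)) _.
exact: Zdiag_linear.
Qed.

End DoubleComplex.

(** * The numerators of a Moebius transform *)

Section AffinePolynomials.
Context {R : realType} {d : nat}.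
Implicit Types p : Apoly R d.

Let affine p := exists c (A : 'I_d -> R[i]),
  p = cpoly d c + \sum_j cpoly d (A j) * zvar R j.

Lemma msize_le2_affine p : (msize p <= 2)%N ->
  exists c (A : 'I_d -> R[i]), p = cpoly d c + \sum_j cpoly d (A j) * zvar R j.
Proof.
move=> p2; rewrite -/(affine p) [p]mpolyE big_seq.
apply: big_ind => [|q r [c [A ->]] [c' [A' ->]]|m mp].
- exists 0, (fun=> 0); rewrite /cpoly mpolyC0 add0r big1// => j _; exact: mul0r.
- exists (c + c'), (fun j => A j + A' j); rewrite /cpoly mpolyCD addrACA -big_split/=.
  by congr (_ + _); apply: eq_bigr => j _; rewrite mpolyCD mulrDl.
- have := leq_trans (msize_mdeg_lt mp) p2; rewrite ltnS leq_eqVlt ltnS leqn0 mdeg_eq0.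
  move=> /orP[/mdeg1P[i /eqP->]|/eqP->].
    exists 0, (fun j => mcoeff (mnm1 i) p * (j == i)%:R).
    rewrite /cpoly mpolyC0 add0r (bigD1 i)//= eqxx mulr1 mul_mpolyC big1 ?addr0// => j /negPf->.
    by rewrite mulr0 mpolyC0 mul0r.
  exists (mcoeff mnm0 p), (fun=> 0); rewrite mpolyX0 /cpoly mpolyC0 -mul_mpolyC mulr1.
  by rewrite big1 ?addr0// => j _; exact: mul0r.
Qed.

Definition centered (A : 'I_d -> R[i]) (l : Cn R d) : Apoly R d :=
  \sum_j cpoly d (A j) * (zvar R j - cpoly d (l 0 j)).

Lemma peval_centered A l z : peval (centered A l) z = \sum_j A j * (z 0 j - l 0 j).
Proof.
rewrite /peval /centered rmorph_sum/=; apply: eq_bigr => j _.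
by rewrite mevalM mevalB /cpoly !mevalC mevalXU.
Qed.

Lemma act_centered (H : hilbertType R) (M : Ad_module d H) A l x :
  M (centered A l) x = \sum_j A j *: (M (zvar R j) x - l 0 j *: x).
Proof.
rewrite act_sum; apply: eq_bigr => j _.
by rewrite actM actC actD act_opp actC.
Qed.

Lemma affine_root p l : (msize p <= 2)%N -> peval p l = 0 -> exists A, p = centered A l.
Proof.
move=> /msize_le2_affine[c [A pE]] pl; exists A; rewrite pE /centered.
under [RHS]eq_bigr do rewrite mulrBr; rewrite sumrB addrC; congr (_ + _).
have := pl; rewrite pE /peval mevalD rmorph_sum/= /cpoly mevalC => /eqP.
rewrite addr_eq0 => /eqP->; rewrite raddfN/= raddf_sum/=; congr (- _).
by apply: eq_bigr => j _; rewrite mevalM mevalC mevalXU mpolyCM.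
Qed.

(** If A were singular, all numerators would vanish along a line through l, and
    phi would take the value 0 = phi l at other points of the ball. *)
Lemma mobius_numerators (phi : Cn R d -> Cn R d) (l : Cn R d) (ell : 'I_d -> Apoly R d) :
  mobius phi -> oball R d l -> phi l = 0 ->
  (forall i, (msize (ell i) <= 2)%N) ->
  (forall i z, cball R d z -> phi z 0 i = peval (ell i) z / (1 - Cdot z l)) ->
  exists2 A : 'M[R[i]]_d, A \in unitmx & forall i, ell i = centered (A i) l.
Proof.
move=> [_ [_ phi_inj _] _ _ _] lB phil ell2 phiE.
have cballW z : oball R d z -> cball R d z by move=> zB; rewrite /cball/= ltW.
have lC := cballW l lB.
have ell_l i : peval (ell i) l = 0.
  have := phiE i l lC; rewrite phil mxE => /esym/eqP.
  by rewrite mulf_eq0 invr_eq0 (negPf (Cdot_neq1 lB lB)) orbF => /eqP.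
have /choice[A AE] i : exists a, ell i = centered a l by exact: affine_root.
exists (\matrix_(i, j) A i j); last first.
  by move=> i; rewrite AE; congr centered; apply/funext => j; rewrite mxE.
rewrite -unitmx_tr unitmxE unitfE; apply/negP => /det0P[v vn0 vA].
have Av i : \sum_j A i j * v 0 j = 0.
  move/rowP: vA => /(_ i); rewrite !mxE => vA; rewrite -[RHS]vA.
  by apply: eq_bigr => j _; rewrite !mxE mulrC.
(* |l + t v|^2 <= |l|^2 + t (|b| + V) for 0 < t <= 1 *)
have [t t0 zB] : exists2 t, t != 0 & oball R d (l + t *: (v : Cn R d)).
  pose V := Csqnorm (v : Cn R d); pose b := Cdot l v + Cdot v l; pose q := 1 - Csqnorm l.
  have q0 : 0 < q by rewrite subr_gt0.
  have V0 : 0 <= V by rewrite sumr_ge0// => *; rewrite exprn_ge0.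
  have D0 : 0 < q + (`|b| + V) + 1 by rewrite -addrA ltr_wpDr// !addr_ge0.
  pose t := q / (q + (`|b| + V) + 1).
  have t0 : 0 < t by rewrite divr_gt0.
  have t1 : t <= 1 by rewrite ler_pdivrMr// mul1r -addrA lerDl !addr_ge0.
  have breal : b \is Num.real by rewrite CrealE /b rmorphD/= -!CdotC addrC.
  exists t; first by rewrite gt_eqF.
  rewrite /oball/= CsqnormE CdotDl !CdotDr !CdotZl !CdotZr -!CsqnormE -/V.
  rewrite (conj_Creal (gtr0_real t0)) -subr_gt0.
  rewrite (_ : 1 - _ = q - (t * b + t * (t * V))); last by rewrite /q /b; ring.
  rewrite subr_gt0; apply: (@le_lt_trans _ _ (t * (`|b| + V))).
    rewrite -mulrDr ler_pM2l// lerD//; first exact: real_ler_norm.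
    by rewrite ler_piMl.
  rewrite /t mulrAC ltr_pdivrMr// ltr_pM2l// -subr_gt0.
  by rewrite (_ : _ - _ = q + 1); [rewrite addr_gt0 | ring].
have zC := cballW _ zB.
have phiz : phi (l + t *: (v : Cn R d)) = 0.
  apply/rowP => i; rewrite phiE// AE peval_centered [RHS]mxE.
  rewrite [X in X / _](_ : _ = 0) ?mul0r//.
  transitivity (t * \sum_j A i j * v 0 j); last by rewrite Av mulr0.
  rewrite mulr_sumr; apply: eq_bigr => j _.
  by rewrite !mxE; ring.
have : l + t *: (v : Cn R d) = l by apply: phi_inj; rewrite ?inE// phiz phil.
move/eqP; rewrite -subr_eq0 addrC addKr scaler_eq0 (negPf t0)/=.
by rewrite (negPf vn0).
Qed.

End AffinePolynomials.

(** * Exactness of the Koszul complexes of free modules *)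

Section FreeExact.
Context {R : realType} {d : nat} {H2 : hilbertType R} {D : drury_arveson d H2}.
Context {C F : hilbertType R} (L : free_module D C F) (l : oball R d).
Variables (A : 'M[R[i]]_d) (a : 'I_d -> {linear F -> F}).
Hypotheses (Aunit : A \in unitmx)
  (aE : forall i x, a i x = \sum_j A i j *: (L (zvar R j) x - val l 0 j *: x)).
Local Notation c := (val l : Cn R d).

Lemma free_eval_linear : linear (fun x => free_eval L x l).
Proof.
move=> k x y; apply: hdot_inj => z.
by rewrite hdotPl !free_evalE hdotPl.
Qed.

Lemma free_eval_tuple i x : free_eval L (a i x) l = 0.
Proof.
apply: hdot_inj => y; rewrite hdot0l free_evalP aE hdot_suml big1// => j _.
by rewrite hdotZl hdotBl free_var_eval ?hdotZl ?subrr ?mulr0//; exact: oball_val.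
Qed.

Lemma free_eval_const y : free_eval L (free_tensor L (da_one D) y) l = y.
Proof.
apply: hdot_inj => z.
by rewrite free_evalE tensor_dot da_reproducing da_oneE ?mul1r//; exact: oball_val.
Qed.

(** Composing a i with the inverse Z of 1 - <T, l> gives the tuple E S, where S is
    the model of [mobius_shift_model] and E is A times the inverse of [mob_mx].
    Since Z is invertible and commutes with the a i, both claims for the tuple a
    follow from those for E S. *)
Lemma free_exact :
  (forall x, free_eval L x l = 0 -> exists y, x = \sum_i a i (y i)) /\
  (forall k (x : {ffun ksubset d k.+1 -> F}), koszul_tuple a x = 0 ->
    exists y : {ffun ksubset d k.+2 -> F}, koszul_tuple a y = x).
Proof.
have cB : oball R d c by exact: oball_val.
have [Z [KZ ZK Zb]] := denom_inverse (free_contractive L) cB.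
have aZ i x : a i (Z x) = Z (a i x).
  rewrite -[LHS]KZ; congr (Z _); rewrite !aE linear_sum; apply: eq_bigr => j _.
  by rewrite linearZ/= linearB/= actCom linearZ/= !ZK.
have /choice[S SE] i : exists h : {linear F -> F}, h =1 (fun x =>
    \sum_j mob_mx c i j *: (L (zvar R j) (Z x) - c 0 j *: Z x)).
  apply: linear_exists => k x y; rewrite scaler_sumr -big_split; apply: eq_bigr => j _ /=.
  rewrite [Z _]linearP [L _ _]linearP [c 0 j *: _]scalerDr opprD addrACA.
  by rewrite [c 0 j *: (k *: _)]scalerA mulrC -scalerA -scalerBr scalerDr !scalerA mulrC.
have model := mobius_shift_model ZK Zb SE.
pose E := A *m invmx (mob_mx c).
have Bunit := mob_mx_unit cB.
have Eunit : E \in unitmx by rewrite unitmx_mul Aunit unitmx_inv.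
have EB i j : \sum_m E i m * mob_mx c m j = A i j.
  have : E *m mob_mx c = A by rewrite mulmxKV.
  by move=> /matrixP/(_ i j); rewrite mxE.
have aZE i x : a i (Z x) = \sum_m E i m *: S m x.
  under eq_bigr do rewrite SE scaler_sumr; rewrite exchange_big aE/=.
  apply: eq_bigr => j _; rewrite -EB scaler_suml; apply: eq_bigr => m _.
  by rewrite scalerA.
have /choice[S' S'E] i : exists h : {linear F -> F}, h =1 (fun x => a i (Z x)).
  by apply: linear_exists => k x y; rewrite !linearP.
split.
  move=> x x0; have ev0 : mob_rad c *: free_eval L x l = 0 by rewrite x0 scaler0.
  have xE := ev0_ideal model ev0; move: (Sa model) xE => T xE.
  have SaE m y : S m y = \sum_i invmx E m i *: a i (Z y).
    have E'E n : \sum_i invmx E m i * E i n = (m == n)%:R.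
      by have /matrixP/(_ m n) := mulVmx Eunit; rewrite !mxE.
    under eq_bigr do rewrite aZE scaler_sumr.
    rewrite exchange_big/= (bigD1 m)//= [X in _ + X]big1 => [|n nm].
      under eq_bigr do rewrite scalerA.
      by rewrite addr0 -scaler_suml E'E eqxx scale1r.
    under eq_bigr do rewrite scalerA.
    by rewrite -scaler_suml E'E eq_sym (negPf nm) scale0r.
  exists (fun i => \sum_m invmx E m i *: Z (T m x)); rewrite {1}xE.
  under eq_bigr do rewrite SaE; rewrite exchange_big/=; apply: eq_bigr => i _.
  by rewrite linear_sum; apply: eq_bigr => m _; rewrite linearZ.
move=> k x x0.
have S'S i y : S' i y = \sum_m E i m *: S m y by rewrite S'E aZE.
have [|y yx] := @shift_koszul_exact _ _ _ _ _ _ _ model E S' Eunit S'S k x.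
  rewrite (@koszul_tuple_comp _ _ _ a S' Z _ _ S'E).
  by rewrite (@koszul_tuple_map _ _ _ _ a) ?x0 ?linear0// => i y; rewrite aZ.
by exists (ffun_map Z y); rewrite -(@koszul_tuple_comp _ _ _ a S' Z _ _ S'E).
Qed.

End FreeExact.

(** * Assembling the double complex *)

Section AugmentedResolution.
Context {R : realType} {d : nat} {H2 : hilbertType R} {D : drury_arveson d H2}.
Context {H : hilbertType R} (M : Ad_module d H) {C F : nat -> hilbertType R}.
Variables (L : forall k, free_module D (C k) (F k)).
Variables (f0 : {linear F 0%N -> H}) (f : forall k, {linear F k.+1 -> F k}).

(** Placing H in position 0 and F n in position n+1 makes the augmentation f0 an
    ordinary horizontal map. *)
Definition aug_space n : hilbertType R := if n is m.+1 then F m else H.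
Definition aug_module n : Ad_module d (aug_space n) :=
  if n is m.+1 then free_act (L m) else M.
Definition aug_map n : {linear aug_space n.+1 -> aug_space n} :=
  if n is m.+1 then f m else f0.

Hypothesis res : free_resolution M L f0 f.

Lemma aug_map_act n p x : aug_map n (aug_module n.+1 p x) = aug_module n p (aug_map n x).
Proof.
by case: res => [[[_ h0] _] h _ _ _]; case: n x => [|n] x; [apply: h0 | apply: (h n).1.2].
Qed.

Lemma aug_map_surj x : exists y, aug_map 0 y = x.
Proof.
case: res => _ _ rangeE _ _.
have [y _ <-] : range f0 x by rewrite rangeE.
by exists y.
Qed.

Lemma aug_map_exact n x : aug_map n x = 0 <-> exists y, aug_map n.+1 y = x.
Proof.
case: res => _ _ _ e0 e.
have : range (aug_map n.+1) = [set x | aug_map n x = 0]%classic.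
  by case: n x => [|n] x; [apply: e0 | apply: e].
move=> rangeE; have E : range (aug_map n.+1) x <-> aug_map n x = 0 by rewrite rangeE.
split=> [/E[y _ <-]|[y yx]]; first by exists y.
by apply/E; exists y.
Qed.

End AugmentedResolution.

Section DegreeZero.
From mathcomp Require Import finset.
Context {K : numFieldType} {d : nat} {V : lmodType K}.

Definition ksubset0 : ksubset d 0 := exist _ finset.set0 (introT eqP (finset.cards0 _)).

Lemma ksubset0P (T : ksubset d 0) : T = ksubset0.
Proof.
by apply: val_inj; apply/eqP; rewrite -cards_eq0; case: T.
Qed.

Lemma koszul_tuple0 (a : 'I_d -> {linear V -> V}) (x : {ffun ksubset d 1 -> V}) :
  koszul_tuple a x ksubset0 = \sum_i a i (kextend x [set i]).
Proof.
rewrite ffunE /kbound; apply: eq_big => [i|i _]; first by rewrite inE.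
rewrite finset.setU0 /ksign (eq_card0 (A := [pred j in _ | _])) ?expr0 ?scale1r// => j.
by rewrite !inE.
Qed.

Lemma koszul_tuple0_onto (a : 'I_d -> {linear V -> V}) (y : 'I_d -> V) :
  exists x : {ffun ksubset d 1 -> V}, koszul_tuple a x ksubset0 = \sum_i a i (y i).
Proof.
pose g (T : {set 'I_d}) : V := if #|T| == 1%N then \sum_(i in T) y i else 0.
exists (krestrict 1 g); rewrite koszul_tuple0; apply: eq_bigr => i _.
rewrite krestrictK => [|T /negPf T1]; last by rewrite /g T1.
by rewrite /g cards1 big_set1.
Qed.

End DegreeZero.

(** The action of M' is that of the ell_i composed with the inverse of the
    denominator, which commutes with it.  This inverse acts bijectively on each
    term of the Koszul complex and commutes with its boundary maps, so that both
    complexes have the same kernels and the same images. *)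
Lemma mobius_koszul_homology (R : realType) (d : nat) (H : hilbertType R)
    (M M' : Ad_module d H) (l : Cn R d) (ell : 'I_d -> Apoly R d) (inv : H -> H) k :
  cancel (M (mobius_denom l)) inv -> cancel inv (M (mobius_denom l)) ->
  (forall i x, M' (zvar R i) x = M (ell i) (inv x)) ->
  let v j : {linear {ffun ksubset d j.+1 -> H} -> {ffun ksubset d j -> H}} :=
    @koszul_tuple _ _ _ (fun i => M (ell i)) j in
  (forall x, v k x = 0 <-> koszul M' (k := k) x = 0) /\
  (forall x, (exists y, v k.+1 y = x) <-> exists y, koszul M' (k := k.+1) y = x).
Proof.
move=> MK KM M'E v.
have [Z ZE] : exists Z : {linear H -> H}, Z =1 inv.
  apply: linear_exists => a x y; apply: (can_inj MK).
  by rewrite KM linearP !KM.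
have ellZ i x : M (ell i) (Z x) = Z (M (ell i) x).
  by rewrite !ZE -[LHS]MK actCom KM.
have kE j x : koszul M' (k := j) x = v j (ffun_map Z x).
  by rewrite koszulE; apply: koszul_tuple_comp => i y; rewrite M'E ZE.
have Zv j x : v j (ffun_map Z x) = ffun_map Z (v j x) by exact: koszul_tuple_map.
split=> x.
  rewrite kE Zv; split => [->|/ffunP vx]; first by rewrite linear0.
  by apply/ffunP => T; move: (vx T); rewrite !ffunE ZE => h; rewrite -[LHS]KM h linear0.
split=> [[y <-]|[y <-]]; last by exists (ffun_map Z y); rewrite kE.
exists (ffun_map (M (mobius_denom l)) y); rewrite kE; congr (v _ _).
by apply/ffunP => T; rewrite !ffunE ZE MK.
Qed.

(* The maps koszul M' k and f k have the index k + 1 in the usual numbering *)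
(* (boundary maps E_{k+1} -> E_k and F_{k+1} -> F_k), so that the homology *)
(* compared is the one at E_{k+1} and at C_{k+1}. *)
Theorem theorem4p3
    (R : realType) (d : nat) (d_gt0 : (0 < d)%N)
    (H2 : hilbertType R) (D : drury_arveson d H2)
    (H : hilbertType R) (M : Ad_module d H)
    (M_contractive : contractive M) (M_pure : pure D M)
    (phi : Cn R d -> Cn R d) (phi_mobius : mobius phi)
    (l : oball R d) (phi_l : phi (val l) = 0)
    (M' : Ad_module d H) (M'_mobius : mobius_transform phi (val l) M M')
    (C F : nat -> hilbertType R) (L : forall k, free_module D (C k) (F k))
    (f0 : {linear F 0%N -> H}) (f : forall k, {linear F k.+1 -> F k})
    (f_resolution : free_resolution M L f0 f) (k : nat) :
  lin_iso
    (homology (koszul M' (k := k.+1)) (koszul M' (k := k)))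
    (homology (localization (L k.+2) (L k.+1) (f k.+1) l)
              (localization (L k.+1) (L k) (f k) l)).
Proof.
have lB : oball R d (val l) := oball_val l.
have [ell [inv [ell2 phiE [MK KM] M'E]]] := M'_mobius.
have [A Aunit ellE] := mobius_numerators phi_mobius lB phi_l ell2 phiE.
pose a p i : {linear @aug_space R H F p -> @aug_space R H F p} := aug_module M L p (ell i).
pose X p q : lmodType R[i] := {ffun ksubset d q -> @aug_space R H F p}.
pose v p q : {linear X p q.+1 -> X p q} := @koszul_tuple _ _ _ (a p) q.
pose h p q : {linear X p.+1 q -> X p q} := @ffun_map _ _ _ _ (aug_map f0 f p) q.
have aE p i x : a p.+1 i x = \sum_j A i j *: (L p (zvar R j) x - val l 0 j *: x).
  by rewrite /a ellE act_centered.
have eps_lin p : linear (fun x : X p.+1 0%N => free_eval (L p) (x ksubset0) l).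
  by move=> c x y; rewrite !ffunE (@free_eval_linear _ _ _ _ _ _ (L p)).
pose eps p : {linear X p.+1 0%N -> C p} := sval (cid (linear_exists (@eps_lin p))).
have epsE p x : eps p x = free_eval (L p) (x ksubset0) l.
  exact: (svalP (cid (linear_exists (@eps_lin p)))).
pose ev p : {linear F p -> C p} := sval (cid (linear_exists (free_eval_linear (L p) l))).
have evE p x : ev p x = free_eval (L p) x l.
  exact: (svalP (cid (linear_exists (free_eval_linear (L p) l)))).
have ev_ideal p (x : 'I_d -> F p) : ev p (\sum_i a p.+1 i (x i)) = 0.
  by rewrite linear_sum big1// => i _; rewrite evE (free_eval_tuple (aE p)).
pose loc p : {linear C p.+1 -> C p} := localization (L p.+1) (L p) (f p) l.
have [mk im] := @mobius_koszul_homology _ _ _ _ _ _ ell inv k MK KM M'E.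
apply: subquot_iso_homology.
apply: subquot_iso_eq mk im _.
apply: (@double_complex_iso _ X C v h eps loc).
- move=> p q x; apply: koszul_tuple_map => i y; exact: aug_map_act f_resolution _ _ _.
- move=> p q x; apply: koszul_tuple2 => i j y; exact: actCom.
- move=> p q x x0; have := (free_exact Aunit (aE p)).2 q x x0.
  exact.
- move=> p q x; apply/ffunP => T; rewrite !ffunE.
  by apply/(aug_map_exact f_resolution); exists (x T).
- move=> p q x; apply: ffun_map_exact => y /(aug_map_exact f_resolution).
  by [].
- move=> q x; have /choice[y yP] T : exists y, aug_map f0 f 0 y = x T.
    exact: aug_map_surj f_resolution _.
  by exists [ffun T => y T]; apply/ffunP => T; rewrite !ffunE.
- by move=> p x; rewrite epsE koszul_tuple0 -evE ev_ideal.
- move=> p x; rewrite epsE => /(free_exact Aunit (aE p)).1[y xE].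
  have [z zE] := koszul_tuple0_onto (a p.+1) y; exists z.
  by apply/ffunP => T; rewrite (ksubset0P T) xE -zE.
- move=> p y; exists [ffun=> free_tensor (L p) (da_one D) y].
  by rewrite epsE ffunE free_eval_const.
(* x - 1 (x) x(l) vanishes at l, hence lies in the range of the tuple a, and so
   does its image under f *)
- move=> p x; rewrite !epsE ffunE /loc/= /localization -!evE.
  set t := free_tensor _ _ _.
  have t0 : free_eval (L p.+1) (x ksubset0 - t) l = 0.
    by rewrite -evE linearB/= [ev _ t]evE free_eval_const subrr.
  have [y yE] := (free_exact Aunit (aE p.+1)).1 _ t0.
  apply/subr0_eq; rewrite -linearB -linearB yE linear_sum/=.
  rewrite -[RHS](ev_ideal p (fun i => f p (y i))); congr (ev p _).
  by apply: eq_bigr => i _; exact: (@aug_map_act _ _ _ _ _ M _ _ L f0 f f_resolution p.+1).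
Qed.
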